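(* Let $\mathcal S\subset\mathbb R^n$ be nonempty, closed and convex, let $F:\mathbb R^n\to\mathbb R^n$ be continuous, and let $\mathbb M:\mathbb R^n\to\mathbb R^{n\times n}$ take symmetric positive definite values. Suppose there are constants $L\ge1$, $K>0$, $K_M>0$, $\mu>0$ such that for all $x,y\in\mathcal S$: $\|\mathbb M(x)\|\le L$, $\|\mathbb M(x)^{-1}\|\le L$, $\|F(x)-F(y)\|\le K\|x-y\|$, $\|\mathbb M(x)-\mathbb M(y)\|\le K_M\|x-y\|$, and $\langle F(x)-F(y),x-y\rangle\ge\mu\|x-y\|^2$. Let $\lambda>0$, $$0<\alpha<\frac{2\mu}{LK^2},\qquad \rho:=\sqrt{1-\frac{2\alpha\mu}{L}+\alpha^2K^2},$$ let $\bar x\in\operatorname{SOL}(F,\mathcal S)$, and put $Q(x):=\mathbb M(x)^{-1}$, $r(x):=\|x-\bar x\|_{Q(x)}$. Set $$C_L:=\tfrac12L^{3/2}K_M(1+\rho).$$ Choose $R$ with $0<R<(1-\rho)/C_L$ and put $\eta_R:=(1-\rho)-C_LR>0$. Then the sublevel set $\{x\in\mathcal S:\ r(x)\le R\}$ is positively invariant for the flow $\dot x=\lambda(T(x)-x)$, every trajectory of this flow with $r(x(0))\le R$ exists for all $t\ge0$, and $$r(x(t))\le e^{-\lambda\eta_Rt}\,r(x(0)),\qquad \|x(t)-\bar x\|\le L\,e^{-\lambda\eta_Rt}\,\|x(0)-\bar x\|.$$ The condition $\|x(0)-\bar x\|<R/\sqrt L$ is sufficient for $r(x(0))<R$. The choice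 $R=(1-\rho)/\bigl(L^{3/2}K_M(1+\rho)\bigr)$, half the admissible supremum, gives $\eta_R=(1-\rho)/2$ and the Euclidean condition $\|x(0)-\bar x\|<(1-\rho)/\bigl(L^2K_M(1+\rho)\bigr)$. (It is called the half-rate choice, since $\eta_R$ tends to $1-\rho$ as $R\to0$ and to zero as $R$ approaches the supremum.)
   Context: $\langle\cdot,\cdot\rangle$ and $\|\cdot\|$ are the Euclidean inner product and norm (operator norm for matrices); for $Q$ symmetric positive definite, $\|x\|_Q:=\sqrt{x^\top Qx}$ and $P_{\mathcal S,Q}(y):=\operatorname{argmin}_{z\in\mathcal S}\tfrac12\|z-y\|_Q^2$ (exists and is unique). $\operatorname{SOL}(F,\mathcal S)$ is the set of $\bar x\in\mathcal S$ with $\langle F(\bar x),x-\bar x\rangle\ge0$ for all $x\in\mathcal S$. The map $T:\mathcal S\to\mathcal S$ is $T(x):=P_{\mathcal S,\mathbb M(x)^{-1}}\bigl(x-\alpha\mathbb M(x)F(x)\bigr)$. Trajectories are locally absolutely continuous $\mathcal S$-valued solutions of $\dot x=\lambda(T(x)-x)$ with $x(0)\in\mathcal S$. A set is positively invariant if every trajectory starting in it remains in it for all $t\ge0$. *)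

(* Defs.v *)
From HB Require Import structures.
From mathcomp Require Import all_boot all_order all_algebra.
From mathcomp Require Import all_classical all_reals all_analysis.

Set Implicit Arguments.
Unset Strict Implicit.
Unset Printing Implicit Defensive.

Import Order.TTheory GRing.Theory Num.Theory.
Import numFieldNormedType.Exports.

Local Open Scope classical_set_scope.
Local Open Scope ring_scope.

(* The library norm `|_| on 'cV[R]_n is the sup norm;
   it is used only through its topology and through [is_derive], which are the
   same for the Euclidean norm [enorm]. *)

Definition dot (R : realType) (n : nat) (u v : 'cV[R]_n) : R :=
  (u^T *m v) ord0 ord0.

Definition enorm (R : realType) (n : nat) (u : 'cV[R]_n) : R :=
  Num.sqrt (dot u u).

Definition wnorm (R : realType) (n : nat) (Q : 'M[R]_n) (u : 'cV[R]_n) : R :=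
  Num.sqrt (dot u (Q *m u)).

Definition opnorm (R : realType) (n : nat) (A : 'M[R]_n) : R :=
  sup [set enorm (A *m u) | u in [set u : 'cV[R]_n | enorm u <= 1]].

Definition spd (R : realType) (n : nat) (A : 'M[R]_n) : Prop :=
  A^T = A /\ forall u : 'cV[R]_n, u != 0 -> 0 < dot u (A *m u).

Definition argmin (R : realType) (U : Type) (S : set U) (g : U -> R) : set U :=
  [set z | S z /\ forall w, S w -> g z <= g w].

(* For S nonempty closed convex and Q symmetric positive definite the argmin
   is a singleton, so the default value 0 of [xget] is never used. *)
Definition proj (R : realType) (n : nat) (S : set 'cV[R]_n) (Q : 'M[R]_n)
    (y : 'cV[R]_n) : 'cV[R]_n :=
  xget 0 (argmin S (fun z => 2^-1 * wnorm Q (z - y) ^+ 2)).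

Definition SOL (R : realType) (n : nat) (F : 'cV[R]_n -> 'cV[R]_n)
    (S : set 'cV[R]_n) : set 'cV[R]_n :=
  [set xb | S xb /\ forall x, S x -> 0 <= dot (F xb) (x - xb)].

Definition Tmap (R : realType) (n : nat) (S : set 'cV[R]_n)
    (F : 'cV[R]_n -> 'cV[R]_n) (M : 'cV[R]_n -> 'M[R]_n) (alpha : R)
    (x : 'cV[R]_n) : 'cV[R]_n :=
  proj S (invmx (M x)) (x - alpha *: (M x *m F x)).

Definition abs_cont (R : realType) (n : nat) (c d : R) (x : R -> 'cV[R]_n) :
    Prop :=
  forall eps : R, 0 < eps -> exists2 delta : R, 0 < delta &
    forall (k : nat) (a b : 'I_k -> R),
      (forall i, c <= a i /\ a i <= b i /\ b i <= d) ->
      trivIset setT (fun i => `]a i, b i[%classic) ->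
      \sum_(i < k) (b i - a i) < delta ->
      \sum_(i < k) enorm (x (b i) - x (a i)) < eps.

(* The time interval starts at 0, which it contains; its right end point [e]
   may be finite (included or not) or +oo ([BInfty R false]).  Values of [x]
   outside the interval are irrelevant: the derivative is two-sided, but the
   end points form a null set. *)
Definition trajectory (R : realType) (n : nat) (S : set 'cV[R]_n)
    (v : 'cV[R]_n -> 'cV[R]_n) (e : itv_bound R) (x : R -> 'cV[R]_n) : Prop :=
  let J := Interval (BLeft 0) e in
  [/\ 0 \in J,
      forall t, t \in J -> S (x t),
      forall c d, c \in J -> d \in J -> abs_cont c d x
    & {ae (@lebesgue_measure R), forall t, t \in J ->
        is_derive (t : R^o) (1 : R^o) (x : R^o -> 'cV[R]_n) (v (x t))}].

Definition positively_invariant (R : realType) (n : nat) (S : set 'cV[R]_n)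
    (v : 'cV[R]_n -> 'cV[R]_n) (A : set 'cV[R]_n) : Prop :=
  forall (e : itv_bound R) (x : R -> 'cV[R]_n), trajectory S v e x ->
    A (x 0) -> forall t, t \in Interval (BLeft 0) e -> A (x t).

(* Main.v *)
Require Import Defs.
From HB Require Import structures.
From mathcomp Require Import all_boot all_order all_algebra.
From mathcomp Require Import all_classical all_reals all_analysis.
From mathcomp Require Import measurable_realfun ring lra.

(* Write [Q x] for the inverse of [M x] and [r x] for the [Q x]-norm of
   [x - xbar].  In the metric frozen at [x], the projection is nonexpansive and
   strong monotonicity makes [T] contract towards [xbar] by the factor [rho].
   Differentiating [r ^ 2] along the flow therefore gives the frozen-metric term
   [- 2 lambda (1 - rho) r ^ 2], while the variation of the metric, which is
   Lipschitz in [x], contributes at most [2 lambda CL r ^ 3].  So, almost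
   everywhere, [(r ^ 2)' <= - 2 lambda (1 - rho - CL r) r ^ 2].

   As trajectories are only absolutely continuous and [Q] is merely Lipschitz
   along them, this differential inequality is used for right increments:
   an absolutely continuous function with nonpositive upper growth almost
   everywhere is nonincreasing.  Existence for all times comes from Picard
   iteration for a globally Lipschitz modification of the field, and the closed
   convex set [S] is invariant because the distance to [S] cannot increase. *)

Set Implicit Arguments.
Unset Strict Implicit.
Unset Printing Implicit Defensive.

Import Order.TTheory GRing.Theory Num.Theory.
Import numFieldNormedType.Exports.

Local Open Scope classical_set_scope.
Local Open Scope ring_scope.

(** * Euclidean and weighted norms *)

Section Euclidean.
Context {R : realType} {n : nat}.
Implicit Types (u v w : 'cV[R]_n) (A B : 'M[R]_n) (a : R).

(** The bounds on [M] and [F] hold on [S] only, so [r] can be compared only at points of [S], and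
    [T] is Lipschitz only on bounded parts of [S], because moving the metric acts on the whole step
    [T y - y]. Existence therefore needs a truncated field, yet the truncation is harmless only once
    [r] is known to stay small. The circle is broken by the order of the two invariance statements.
    The truncated field still points everywhere to a point of [S], so [S] is invariant without any
    bound on [r]. The bound on [r] then needs the true field only where [r] lies below a slightly
    larger radius, and there the truncation is inactive. [M] need not be differentiable. The
    derivative of the metric is replaced by the identity [Q y - Q x = Q y (M x - M y) Q x], in which
    the vector [Q x (x - xbar)] is kept whole; estimating its factors separately would put a higher
    power of [L] into [CL]. An arbitrary trajectory is handled by uniqueness: it coincides with the
    constructed one as long as it lasts. *)

Lemma dotE u v : dot u v = \sum_i u i 0 * v i 0.
Proof. by rewrite /dot mxE; apply: eq_bigr => i _; rewrite mxE. Qed.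

Lemma dotC u v : dot u v = dot v u.
Proof. by rewrite !dotE; apply: eq_bigr => i _; rewrite mulrC. Qed.

Lemma dotDr u v w : dot u (v + w) = dot u v + dot u w.
Proof. by rewrite /dot mulmxDr mxE. Qed.

Lemma dotZr a u v : dot u (a *: v) = a * dot u v.
Proof. by rewrite /dot -scalemxAr mxE. Qed.

Lemma dotNr u v : dot u (- v) = - dot u v.
Proof. by rewrite -scaleN1r dotZr mulN1r. Qed.

Lemma dotBr u v w : dot u (v - w) = dot u v - dot u w.
Proof. by rewrite dotDr dotNr. Qed.

Lemma dotDl u v w : dot (u + v) w = dot u w + dot v w.
Proof. by rewrite dotC dotDr !(dotC w). Qed.

Lemma dotZl a u v : dot (a *: u) v = a * dot u v.
Proof. by rewrite dotC dotZr (dotC v). Qed.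

Lemma dotNl u v : dot (- u) v = - dot u v.
Proof. by rewrite dotC dotNr (dotC v). Qed.

Lemma dot0r u : dot u 0 = 0.
Proof. by rewrite /dot mulmx0 mxE. Qed.

Lemma dot0l u : dot 0 u = 0.
Proof. by rewrite dotC dot0r. Qed.

Definition dot_lin := (dotDr, dotDl, dotNr, dotNl, dotZr, dotZl).

Lemma dot_ge0 u : 0 <= dot u u.
Proof. by rewrite dotE sumr_ge0 // => i _; rewrite -expr2 sqr_ge0. Qed.

Lemma dot_eq0 u : (dot u u == 0) = (u == 0).
Proof.
apply/idP/eqP => [|->]; last by rewrite dot0r.
rewrite dotE psumr_eq0 => [/allP h|i _]; last by rewrite -expr2 sqr_ge0.
apply/matrixP => i j; rewrite (ord1 j) mxE.
by have := h i (mem_index_enum i); rewrite mulf_eq0 orbb => /eqP.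
Qed.

Lemma dot_gt0 u : u != 0 -> 0 < dot u u.
Proof. by move=> u0; rewrite lt_neqAle dot_ge0 eq_sym dot_eq0 u0. Qed.

Lemma dot_mull A u v : dot (A *m u) v = dot u (A^T *m v).
Proof. by rewrite /dot trmx_mul mulmxA. Qed.

Lemma dot_sym A u v : A^T = A -> dot u (A *m v) = dot v (A *m u).
Proof. by move=> AT; rewrite dotC dot_mull AT. Qed.

Lemma spd1 : spd (1%:M : 'M[R]_n).
Proof. by split=> [|u u0]; rewrite ?trmx1 // mul1mx dot_gt0. Qed.

Lemma spd_ge0 A u : spd A -> 0 <= dot u (A *m u).
Proof.
by move=> -[_ A0]; have [->|/A0/ltW//] := eqVneq u 0; rewrite dot0l.
Qed.

Lemma spd_CauchySchwarz A u v : spd A ->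
  dot u (A *m v) ^+ 2 <= dot u (A *m u) * dot v (A *m v).
Proof.
move=> sA; have [AT A0] := sA.
have [->|/A0 v0] := eqVneq v 0; first by rewrite !(mulmx0, dot0r) mulr0 expr0n.
(* At this vector the form equals [q * (p * q - s ^ 2)], and the positive factor [q] cancels. *)
have := spd_ge0 (dot v (A *m v) *: u - dot u (A *m v) *: v) sA.
rewrite mulmxBr -!scalemxAr !dot_lin (dot_sym v u AT).
set p := dot u (A *m u); set q := dot v (A *m v) in v0 *; set s := dot u _.
move=> h; rewrite -subr_ge0 -(pmulr_rge0 _ v0).
by apply: le_trans h _; rewrite le_eqVlt; apply/orP; left; apply/eqP; ring.
Qed.

Lemma enorm_ge0 u : 0 <= enorm u. Proof. exact: sqrtr_ge0. Qed.

Lemma sqr_enorm u : enorm u ^+ 2 = dot u u.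
Proof. by rewrite sqr_sqrtr ?dot_ge0. Qed.

Lemma enorm0 : enorm (0 : 'cV[R]_n) = 0.
Proof. by rewrite /enorm dot0r sqrtr0. Qed.

Lemma enorm_eq0 u : (enorm u == 0) = (u == 0).
Proof. by rewrite -(sqrf_eq0 (enorm u)) sqr_enorm dot_eq0. Qed.

Lemma enormZ a u : enorm (a *: u) = `|a| * enorm u.
Proof.
by rewrite /enorm dotZl dotZr mulrA -expr2 sqrtrM ?sqr_ge0 // sqrtr_sqr.
Qed.

Lemma enormN u : enorm (- u) = enorm u.
Proof. by rewrite -scaleN1r enormZ normrN1 mul1r. Qed.

Lemma enormC u v : enorm (u - v) = enorm (v - u).
Proof. by rewrite -enormN opprB. Qed.

Lemma abs_dot_le u v : `|dot u v| <= enorm u * enorm v.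
Proof.
rewrite -ler_sqr ?nnegrE ?mulr_ge0 ?enorm_ge0 ?normr_ge0 //.
rewrite real_normK ?num_real // exprMn !sqr_enorm.
by have := spd_CauchySchwarz u v spd1; rewrite !mul1mx.
Qed.

Lemma dot_le u v : dot u v <= enorm u * enorm v.
Proof. exact: le_trans (ler_norm _) (abs_dot_le u v). Qed.

Lemma ler_enormD u v : enorm (u + v) <= enorm u + enorm v.
Proof.
rewrite -ler_sqr ?nnegrE ?addr_ge0 ?enorm_ge0 //.
rewrite sqrrD !sqr_enorm !dot_lin (dotC v u).
have := dot_le u v; lra.
Qed.

Lemma ler_enormB u v : enorm (u - v) <= enorm u + enorm v.
Proof. by rewrite -(enormN v) ler_enormD. Qed.

Lemma ler_enorm_distD w u v : enorm (u - v) <= enorm (u - w) + enorm (w - v).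
Proof. by rewrite -[X in enorm X](subrKA w) ler_enormD. Qed.

Lemma ler_enorm_sum (I : finType) (f : I -> 'cV[R]_n) :
  enorm (\sum_i f i) <= \sum_i enorm (f i).
Proof.
elim/big_ind2 : _ => [|x1 x2 y1 y2 h1 h2|//]; first by rewrite enorm0.
exact: le_trans (ler_enormD _ _) (lerD h1 h2).
Qed.

Lemma coord_le_enorm u i : `|u i 0| <= enorm u.
Proof.
rewrite -ler_sqr ?nnegrE ?enorm_ge0 // real_normK ?num_real // sqr_enorm dotE.
rewrite (bigD1 i) //= expr2 lerDl sumr_ge0 // => j _.
by rewrite -expr2 sqr_ge0.
Qed.

Lemma normr_le_enorm u : `|u| <= enorm u.
Proof.
rewrite [`|u|]/Num.norm/= mx_normrE; apply: bigmax_le => [|[i j] _ /=].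
  exact: enorm_ge0.
by rewrite (ord1 j) coord_le_enorm.
Qed.

Lemma coord_le_normr u i : `|u i 0| <= `|u|.
Proof.
rewrite [`|u|]/Num.norm/= mx_normrE.
exact: (@le_bigmax _ _ _ _ (fun k : 'I_n * 'I_1 => `|u k.1 k.2|) (i, ord0)).
Qed.

Lemma enorm_delta i : enorm (delta_mx i 0 : 'cV[R]_n) = 1.
Proof.
rewrite /enorm dotE (bigD1 i) //= big1 => [|j /negPf ji].
  by rewrite !mxE !eqxx addr0 mulr1 sqrtr1.
by rewrite !mxE ji mul0r.
Qed.

Lemma enorm_le_normr u : enorm u <= n%:R * `|u|.
Proof.
have uE : u = \sum_i u i 0 *: delta_mx i 0.
  by rewrite {1}(matrix_sum_delta u); apply: eq_bigr => i _; rewrite big_ord1.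
rewrite {1}uE; apply: le_trans (ler_enorm_sum _) _.
apply: (@le_trans _ _ (\sum_(i < n) `|u|)).
  by apply: ler_sum => i _; rewrite enormZ enorm_delta mulr1 coord_le_normr.
by rewrite sumr_const card_ord mulr_natl.
Qed.

Lemma enorm_mul_le A u : enorm (A *m u) <= (\sum_i enorm (col i A)) * enorm u.
Proof.
have -> : A *m u = \sum_i u i 0 *: col i A.
  apply/matrixP => k j; rewrite !mxE summxE (ord1 j).
  by apply: eq_bigr => i _; rewrite !mxE mulrC.
apply: le_trans (ler_enorm_sum _) _; rewrite mulr_suml; apply: ler_sum => i _.
by rewrite enormZ mulrC ler_wpM2l ?enorm_ge0 // coord_le_enorm.
Qed.

(** The supremum in [opnorm] bounds its members only if their set is bounded above; the sum of the
    column norms provides such a bound. *)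
Lemma enorm_mul_ball_le A u : enorm u <= 1 -> enorm (A *m u) <= opnorm A.
Proof.
move=> u1; apply: ub_le_sup; last by exists u.
exists (\sum_i enorm (col i A)) => _ [w /= w1 <-].
apply: le_trans (enorm_mul_le _ _) _; rewrite ler_piMr //.
by apply: sumr_ge0 => i _; rewrite enorm_ge0.
Qed.

Lemma opnorm_ge0 A : 0 <= opnorm A.
Proof.
by apply: le_trans (enorm_ge0 (A *m 0)) _; apply: enorm_mul_ball_le; rewrite enorm0.
Qed.

Lemma enorm_mul_opnorm A u : enorm (A *m u) <= opnorm A * enorm u.
Proof.
have [->|u0] := eqVneq u 0; first by rewrite mulmx0 enorm0 mulr0.
have nu0 : 0 < enorm u by rewrite lt_neqAle enorm_ge0 eq_sym enorm_eq0 u0.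
rewrite -ler_pdivrMr //.
have := @enorm_mul_ball_le A ((enorm u)^-1 *: u).
rewrite -scalemxAr !enormZ ger0_norm ?invr_ge0 ?enorm_ge0 //.
by rewrite mulVf ?gt_eqF // mulrC => ->.
Qed.

Lemma opnorm_leP A a u : opnorm A <= a -> enorm (A *m u) <= a * enorm u.
Proof.
by move=> Aa; apply: le_trans (enorm_mul_opnorm _ _) _; rewrite ler_wpM2r ?enorm_ge0.
Qed.

Lemma dot_opnorm_le A a u : opnorm A <= a -> dot u (A *m u) <= a * dot u u.
Proof.
move=> Aa; apply: le_trans (dot_le _ _) _; rewrite -sqr_enorm expr2 mulrCA.
by rewrite ler_wpM2l ?enorm_ge0 // opnorm_leP.
Qed.

Lemma spd_unitmx A : spd A -> A \in unitmx.
Proof.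
move=> [AT A0]; rewrite -row_free_unit -kermx_eq0; apply/eqP/row_matrixP => i.
rewrite row0; apply/eqP/contraT => k0.
have /A0 : (row i (kermx A))^T != 0 by rewrite trmx_eq0.
by rewrite /dot trmxK mulmxA -row_mul mulmx_ker row0 mul0mx mxE ltxx.
Qed.

Lemma spd_inv A : spd A -> spd (invmx A).
Proof.
move=> sA; have Au := spd_unitmx sA; have [AT A0] := sA.
split=> [|u u0]; first by rewrite trmx_inv AT.
have {1}-> : u = A *m (invmx A *m u) by rewrite mulKVmx.
rewrite dotC A0 //; apply: contraNneq u0 => h.
by rewrite -(mulKVmx Au u) h mulmx0.
Qed.

(* Cauchy-Schwarz for the inner product of [A^-1], applied to [u] and [A u]. *)
Lemma dot_le_inv A a u : spd A -> opnorm A <= a ->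
  dot u u <= a * dot u (invmx A *m u).
Proof.
move=> sA Aa; have Au := spd_unitmx sA.
have [->|u0] := eqVneq u 0; first by rewrite dot0l dot0l mulr0.
have := spd_CauchySchwarz u (A *m u) (spd_inv sA).
rewrite mulKmx // (dotC _ u) => h; have uu := dot_gt0 u0.
have := ler_wpM2r (spd_ge0 u (spd_inv sA)) (dot_opnorm_le u Aa).
rewrite mulrC => h'; rewrite -(ler_pM2l uu) -expr2 mulrCA mulrA.
by apply: le_trans h'; apply: le_trans h.
Qed.

(** This is [dot_le_inv] for the inverse matrix, taken at the vector [invmx A *m u]. It avoids a
    detour through [enorm u], which would cost further powers of [L] in [CL]. *)
Lemma enorm_inv_le A a u : spd A -> opnorm (invmx A) <= a ->
  enorm (invmx A *m u) ^+ 2 <= a * dot u (invmx A *m u).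
Proof.
move=> sA Aa; have := dot_le_inv (invmx A *m u) (spd_inv sA) Aa.
by rewrite invmxK mulKVmx ?spd_unitmx // sqr_enorm (dotC u).
Qed.

Lemma invmxB A B : A \in unitmx -> B \in unitmx ->
  invmx A - invmx B = invmx A *m (B - A) *m invmx B.
Proof.
by move=> Au Bu; rewrite mulmxBr mulmxBl mulmxK // mulVmx // mul1mx.
Qed.

End Euclidean.

(** * Almost everywhere differential inequalities *)

Section AbsolutelyContinuous.
Context {R : realType}.
Implicit Types (f : R -> R) (a b c d t : R) (U : set R).
Local Notation mu := (@lebesgue_measure R).

Lemma ae_lebesgueS (P P' : R -> Prop) : (forall t, P t -> P' t) ->
  {ae mu, forall t, P t} -> {ae mu, forall t, P' t}.
Proof.
by move=> PP'; apply: filterS; first exact: (ae_filter_ringOfSetsType mu).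
Qed.

Lemma ae_lebesgueS2 (P1 P2 P' : R -> Prop) : (forall t, P1 t -> P2 t -> P' t) ->
  {ae mu, forall t, P1 t} -> {ae mu, forall t, P2 t} -> {ae mu, forall t, P' t}.
Proof.
by move=> PP'; apply: filterS2; first exact: (ae_filter_ringOfSetsType mu).
Qed.

(* [abs_cont c d x] is convertible to [small_incr c d E] for the increments
   [E s t := enorm (x t - x s)]. *)
Definition small_incr c d (E : R -> R -> R) : Prop :=
  forall eps : R, 0 < eps -> exists2 delta : R, 0 < delta &
    forall (k : nat) (a b : 'I_k -> R),
      (forall i, c <= a i /\ a i <= b i /\ b i <= d) ->
      trivIset setT (fun i => `]a i, b i[%classic) ->
      \sum_(i < k) (b i - a i) < delta ->
      \sum_(i < k) E (a i) (b i) < eps.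

Definition real_abs_cont c d f : Prop :=
  small_incr c d (fun s t => `|f t - f s|).

(** * Calculus of functions with small increments *)

Lemma small_incr_continuous c d (E : R -> R -> R) : small_incr c d E ->
  forall eps, 0 < eps -> exists2 delta, 0 < delta &
    forall s t, c <= s -> s <= t -> t <= d -> t - s < delta -> E s t < eps.
Proof.
move=> Eac eps /Eac[delta d0 h]; exists delta => // s t cs st td tsd.
have := h 1%N (fun=> s) (fun=> t); rewrite !big_ord1; apply=> //.
by move=> i j _ _ _; rewrite (ord1 i) (ord1 j).
Qed.

Lemma small_incr_dominated c d (E E' : R -> R -> R) (C : R) : 0 < C ->
  (forall s t, c <= s -> s <= t -> t <= d -> E' s t <= C * (E s t + (t - s))) ->
  small_incr c d E -> small_incr c d E'.
Proof.
move=> C0 dom Eac eps eps0.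
have e0 : 0 < eps / 2 / C by rewrite !divr_gt0.
have [delta d0 h] := Eac _ e0.
exists (Num.min delta (eps / 2 / C)) => [|k a b ab dis]; first by rewrite lt_min d0.
rewrite lt_min => /andP[lt1 lt2].
apply: (@le_lt_trans _ _ (C * (\sum_(i < k) E (a i) (b i) + \sum_(i < k) (b i - a i)))).
  rewrite -big_split mulr_sumr; apply: ler_sum => i _.
  by have [? [? ?]] := ab i; exact: dom.
rewrite mulrC -ltr_pdivlMr // [eps]splitr mulrDl.
by apply: ltrD lt2; exact: h.
Qed.

Lemma small_incrD c d (E E' : R -> R -> R) :
  small_incr c d E -> small_incr c d E' ->
  small_incr c d (fun s t => E s t + E' s t).
Proof.
move=> Eac Eac' eps eps0; have e0 : 0 < eps / 2 by rewrite divr_gt0.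
have [d1 d10 h1] := Eac _ e0; have [d2 d20 h2] := Eac' _ e0.
exists (Num.min d1 d2) => [|k a b ab dis]; first by rewrite lt_min d10.
rewrite lt_min => /andP[lt1 lt2]; rewrite big_split [eps]splitr.
by apply: ltrD; [exact: h1|exact: h2].
Qed.

(** Each step of length [delta / 2] adds at most 1, so the number of steps needed to cross the
    interval is a bound. *)
Lemma small_incr_bounded c d (E : R -> R -> R) :
  (forall t, E t t <= 0) -> (forall s t u, E s u <= E s t + E t u) ->
  small_incr c d E -> exists2 B, 0 <= B & forall t, c <= t -> t <= d -> E c t <= B.
Proof.
move=> E0 Etri /small_incr_continuous/(_ 1 ltr01)[delta d0 h].
have step (k : nat) : forall t, c <= t -> t <= d -> t - c <= k%:R * (delta / 2) ->
    E c t <= k%:R.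
  elim: k => [|k ih] t ct td; first rewrite mul0r subr_le0 => tc.
    by have -> : t = c by apply/le_anti; rewrite ct tc.
  rewrite -natr1 mulrDl mul1r => tk.
  pose s := Num.max c (t - delta / 2).
  have cs : c <= s by rewrite le_max lexx.
  have st : s <= t by rewrite ge_max ct gerBl divr_ge0 // ltW.
  apply: le_trans (Etri c s t) _; apply: lerD.
    apply: ih => //; first exact: le_trans td.
    have : 0 <= k%:R * (delta / 2) by rewrite mulr_ge0 // divr_ge0 // ltW.
    by rewrite /s /Num.max; case: ifP => _; lra.
  apply/ltW/h => //; have : t - delta / 2 <= s by rewrite le_max lexx orbT.
  by lra.
pose k := Num.bound (`|d - c| / (delta / 2)).
exists k%:R => // t ct td; apply: step => //.
rewrite -ler_pdivrMr ?divr_gt0 //.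
have d20 : 0 < delta / 2 by rewrite divr_gt0.
have /ltW := archi_boundP (divr_ge0 (normr_ge0 (d - c)) (ltW d20)).
apply: le_trans; rewrite ler_pM2r ?invr_gt0 ?divr_gt0 //.
by apply: le_trans (ler_norm _); rewrite lerD2r.
Qed.

(* [chain U a t s] : [s] lists, from right to left, successive subintervals of
   [a, t] whose interiors lie in [U]. *)
Fixpoint chain U a t (s : seq (R * R)) : Prop :=
  if s is p :: s' then
    [/\ p.2 <= t, p.1 <= p.2, `]p.1, p.2[ `<=` U & chain U a p.1 s']
  else a <= t.

Definition chain_var f (s : seq (R * R)) : R :=
  \sum_(p <- s) `|f p.2 - f p.1|.

Lemma chain_le U a t s : chain U a t s -> a <= t.
Proof.
elim: s t => //= p s ih t [p2t p12 _ /ih ap].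
exact: le_trans (le_trans ap p12) p2t.
Qed.

Lemma chain_widen U a t t' s : t <= t' -> chain U a t s -> chain U a t' s.
Proof.
case: s => [|p s] /= tt'; first by move=> /le_trans; apply.
by move=> [p2t *]; split=> //; exact: le_trans tt'.
Qed.

Lemma chain_mem U a t s : chain U a t s ->
  {in s, forall p, [/\ a <= p.1, p.1 <= p.2 & p.2 <= t]}.
Proof.
elim: s t => //= q s ih t [q2t q12 _ qs] p.
rewrite inE => /predU1P[->|/(ih _ qs)[ap p12 p2q]].
  by split=> //; exact: chain_le qs.
by split=> //; apply: le_trans q2t; exact: le_trans q12.
Qed.

Lemma chain_pairwise U a t s : chain U a t s ->
  pairwise (fun p q : R * R => q.2 <= p.1) s.
Proof.
elim: s t => //= q s ih t [_ _ _ qs]; apply/andP; split; last exact: ih qs.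
by apply/allP => p /(chain_mem qs)[].
Qed.

(** The rightmost interval lies in [U], to the right of all others, so the lengths add up inside
    [U]. *)
Lemma chain_length U a t s : open U -> chain U a t s ->
  ((\sum_(p <- s) (p.2 - p.1))%:E <= mu (U `&` `]a, t[%classic))%E.
Proof.
move=> oU; elim: s t => [|p s ih] t /=; first by rewrite big_nil measure_ge0.
move=> [p2t p12 pU ps]; rewrite big_cons EFinD.
have ap := chain_le ps.
have mU z : measurable (U `&` `]a, z[%classic).
  by apply: measurableI => //; exact: open_measurable.
have -> : (p.2 - p.1)%:E = mu `]p.1, p.2[%classic.
  rewrite lebesgue_measure_itv /= lte_fin; case: ltP => [_|p21]; rewrite ?EFinB //.
  by rewrite (@le_anti _ _ p.1 p.2) ?p12 // subee.
apply: le_trans (leeD2l _ (ih _ ps)) _.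
have <- : mu (`]p.1, p.2[ `|` (U `&` `]a, p.1[)) =
    (mu `]p.1, p.2[%classic + mu (U `&` `]a, p.1[%classic))%E.
  apply: measureU => //; [exact: mU|]; rewrite -subset0 => z [/= + [_ /=]].
  rewrite !in_itv /= => /andP[p1z _] /andP[_].
  by rewrite ltNge (ltW p1z).
apply: le_measure; rewrite ?inE;
  [by apply: measurableU => //; exact: mU|exact: mU|].
move=> z [zp|[Uz /= zap]]; split=> //=; first exact: pU.
  move: zp; rewrite /= !in_itv /= => /andP[p1z zp2].
  by rewrite (le_lt_trans ap p1z) (lt_le_trans zp2 p2t).
move: zap; rewrite !in_itv /= => /andP[-> zp1] /=.
exact: lt_le_trans zp1 (le_trans p12 p2t).
Qed.

(** One [delta] serves all chains in [U] at once, so the supremum of their variations is small as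
    soon as [U] has small measure. *)
Lemma chain_var_lt f a b eps : real_abs_cont a b f -> 0 < eps ->
  exists2 delta, 0 < delta & forall U t s, open U -> (mu U < delta%:E)%E ->
    t <= b -> chain U a t s -> chain_var f s < eps.
Proof.
move=> fac /fac[delta d0 h]; exists delta => // U t s oU Ud tb ch.
pose x0 : R * R := (0, 0).
have -> : chain_var f s =
    \sum_(i < size s) `|f (nth x0 s i).2 - f (nth x0 s i).1|.
  by rewrite /chain_var (big_nth x0) big_mkord.
apply: h => [i||].
- have [? ? ?] := chain_mem ch (mem_nth x0 (ltn_ord i)).
  by split=> //; split=> //; exact: le_trans tb.
- move=> i j _ _ [z [/= zi zj]].
  have lt_absurd (k l : 'I_(size s)) : (k < l)%N ->
      z \in `](nth x0 s k).1, (nth x0 s k).2[ ->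
      z \in `](nth x0 s l).1, (nth x0 s l).2[ -> False.
    rewrite !in_itv /= => kl /andP[kz _] /andP[_ zl].
    have /(pairwiseP x0)/(_ k l (ltn_ord k) (ltn_ord l) kl) := chain_pairwise ch.
    by move=> /(lt_le_trans zl) /(lt_trans kz); rewrite ltxx.
  by apply: val_inj; case: (ltngtP i j) => // /lt_absurd; [case|move=> /(_ zj zi)].
- have -> : \sum_(i < size s) ((nth x0 s i).2 - (nth x0 s i).1) =
      \sum_(p <- s) (p.2 - p.1) by rewrite (big_nth x0) big_mkord.
  rewrite -lte_fin (le_lt_trans (chain_length oU ch)) // (le_lt_trans _ Ud) //.
  apply: le_measure; rewrite ?inE; last exact: subIsetl.
    by apply: measurableI => //; exact: open_measurable.
  exact: open_measurable.
Qed.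

(* Growth on the exceptional null set is charged to the variation of [f] over a
   small open neighbourhood [U] of it, which [phi] measures. *)
Lemma real_abs_cont_nonincr a b f : a <= b -> real_abs_cont a b f ->
  {ae mu, forall t, a <= t -> t < b -> forall eps, 0 < eps ->
    exists2 h, 0 < h & t + h <= b /\ f (t + h) <= f t + eps * h} ->
  f b <= f a.
Proof.
move=> ab fac [N [mN N0 hN]].
apply/ler_addgt0Pr => eta eta0.
(* [eps] is used twice, as the tolerated slope and as the bound on [phi]; the total error is
   [eps * (b - a) + eps = eta]. *)
pose eps := eta / (b - a + 1).
have ba1 : 0 < b - a + 1 by rewrite ltr_wpDl // subr_ge0.
have eps0 : 0 < eps by rewrite divr_gt0.
have [delta delta0 hdelta] := chain_var_lt fac eps0.
have [|U [oU NU Udelta]] := @lebesgue_regularity_outer R N delta mN _ delta0.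
  by rewrite [X in (X < _)%E]N0 ltry.
have mU := open_measurable oU.
have muU : (mu U < delta%:E)%E.
  rewrite -(setDUK NU) measureU ?[X in (X + _)%E]N0 ?add0e //.
    exact: measurableD.
  by rewrite setDIK.
pose V t := [set chain_var f s | s in chain U a t].
pose phi t := sup (V t).
have V0 t : a <= t -> V t 0 by move=> at_; exists [::] => //; rewrite /chain_var big_nil.
have Vub t : t <= b -> ubound (V t) eps.
  by move=> tb _ [s cs <-]; apply/ltW; exact: hdelta tb cs.
have hsV t : a <= t -> t <= b -> has_sup (V t).
  by move=> at_ tb; split; [exists 0; exact: V0|exists eps; exact: Vub].
have phi_le t : a <= t -> t <= b -> phi t <= eps.
  by move=> at_ tb; apply: ge_sup; [exists 0; exact: V0|exact: Vub].
have phi_ge0 t : a <= t -> t <= b -> 0 <= phi t.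
  by move=> at_ tb; apply: sup_upper_bound; [exact: hsV|exact: V0].
have phi_homo s t : a <= s -> s <= t -> t <= b -> phi s <= phi t.
  move=> as_ st tb; apply: ge_sup; first by exists 0; exact: V0.
  move=> _ [q cq <-]; apply: sup_upper_bound.
    by apply: hsV => //; exact: le_trans st.
  by exists q => //; exact: chain_widen cq.
have phi_jump s t : a <= s -> s <= t -> t <= b -> `]s, t[ `<=` U ->
    phi s + `|f t - f s| <= phi t.
  move=> as_ st tb stU; rewrite -lerBrDr; apply: ge_sup.
    by exists 0; exact: V0.
  move=> _ [q cq <-]; rewrite lerBrDr addrC.
  apply: sup_upper_bound; first by apply: hsV => //; exact: le_trans st.
  by exists ((s, t) :: q) => //; rewrite /chain_var big_cons.
(* Real induction on [E]: its supremum [tau] belongs to [E], by continuity of [f] and monotonicity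
   of [phi], and if [tau < b] a single step to the right inside [E] gives a contradiction. *)
pose E := [set t | [/\ a <= t, t <= b & f t <= f a + eps * (t - a) + phi t]].
have Ea : E a by split=> //; rewrite subrr mulr0 addr0 lerDl phi_ge0.
have hsE : has_sup E by split; [exists a|exists b => t []].
pose tau := sup E.
have atau : a <= tau by exact: sup_upper_bound.
have taub : tau <= b by apply: ge_sup; [exists a|move=> t []].
have Etau : E tau.
  split=> //; apply/ler_addgt0Pr => e e0.
  have [d d0 hd] := small_incr_continuous fac e0.
  have [t Et taut] := sup_adherent d0 hsE.
  have ttau : t <= tau by exact: sup_upper_bound.
  have [at_ tb ht] := Et.
  have : `|f tau - f t| < e.
    by apply: hd => //; move: taut; rewrite -/tau; lra.
  rewrite ltr_norml => /andP[_ h1].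
  have h2 := phi_homo _ _ at_ ttau taub.
  have : eps * (t - a) <= eps * (tau - a) by rewrite ler_wpM2l ?(ltW eps0) // lerD2r.
  by lra.
have [_ _ htau] := Etau.
have [taub'|] := ltP tau b; last first.
  move=> btau; have tb : tau = b by apply/le_anti; rewrite taub btau.
  move: htau; rewrite tb => /le_trans; apply.
  have := phi_le b ab (lexx b).
  have : eps * (b - a) + eps = eta by rewrite /eps; field; rewrite gt_eqF.
  by lra.
suff [h h0 [tauh Eh]] : exists2 h, 0 < h & tau + h <= b /\ E (tau + h).
  have : tau + h <= tau by exact: sup_upper_bound.
  by rewrite gerDl leNgt h0.
(* At an exceptional point nothing is known about growth, but an interval to the right of [tau] lies
   in [U], and [phi_jump] absorbs the whole increment of [f]. *)
have [Ntau|Ntau] := pselect (N tau).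
  have [r r0 hr] : exists2 r : R, 0 < r & `]tau, tau + r[ `<=` U.
    have /(_ _ (NU _ Ntau))[r /= r0 hr] : forall x, U x -> nbhs x U by move: oU; rewrite openE.
    exists r => // z /=; rewrite in_itv /= => /andP[tz zt]; apply: hr.
    by rewrite /= ltr0_norm ?subr_lt0 // opprB ltrBlDl.
  pose h := Num.min r (b - tau).
  have h0 : 0 < h by rewrite lt_min r0 subr_gt0.
  have tauh : tau + h <= b by rewrite -lerBrDl ge_min lexx orbT.
  exists h => //; split=> //; split=> //; first by rewrite ler_wpDr // ltW.
  have : phi tau + `|f (tau + h) - f tau| <= phi (tau + h).
    apply: phi_jump => //; first by rewrite lerDl ltW.
    apply: subset_trans hr => z /=; rewrite !in_itv /= => /andP[-> zh] /=.
    by rewrite (lt_le_trans zh) // lerD2l ge_min lexx.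
  have := ler_norm (f (tau + h) - f tau).
  have : 0 <= eps * h by rewrite mulr_ge0 // ltW.
  have : eps * (tau + h - a) = eps * (tau - a) + eps * h by ring.
  by lra.
have /contrapT/(_ atau taub' _ eps0)[h h0 [tauh fh]] := contra_not (hN tau) Ntau.
exists h => //; split=> //; split=> //; first by rewrite ler_wpDr // ltW.
have : phi tau <= phi (tau + h) by apply: phi_homo => //; rewrite lerDl ltW.
have : eps * (tau + h - a) = eps * (tau - a) + eps * h by ring.
by lra.
Qed.

(** The tangent inequality [1 + x <= expR x] gives a one-sided bound, which is applied to the two
    points in either order. *)
Lemma expR_lipschitz_on c b s t : 0 <= s -> s <= t -> t <= b ->
  `|expR (c * t) - expR (c * s)| <= expR (`|c| * b) * (`|c| * (t - s)).
Proof.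
move=> s0 st tb.
have sub_le (x y : R) : expR x - expR y <= expR x * (x - y).
  have := expR_ge1Dx (y - x); rewrite expRD expRN => h.
  have := ler_wpM2l (expR_ge0 x) h; rewrite mulrCA divff ?mulr1 ?gt_eqF ?expR_gt0 //.
  by lra.
have le_b u : 0 <= u -> u <= b -> expR (c * u) <= expR (`|c| * b).
  move=> u0 ub; rewrite ler_expR; apply: le_trans (ler_norm _) _.
  by rewrite normrM (ger0_norm u0) ler_wpM2l.
have bound u w : 0 <= u -> u <= b -> `|u - w| = t - s ->
    expR (c * u) - expR (c * w) <= expR (`|c| * b) * (`|c| * (t - s)).
  move=> u0 ub uw; apply: le_trans (sub_le _ _) _.
  apply: le_trans (ler_wpM2l (expR_ge0 _) (ler_norm _)) _.
  rewrite -mulrBr normrM uw ler_wpM2r ?le_b // mulr_ge0 // subr_ge0 //.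
rewrite ler_norml; apply/andP; split; last first.
  by apply: bound; rewrite ?(le_trans s0) // ger0_norm // subr_ge0.
rewrite lerNl opprB; apply: bound => //; first exact: le_trans tb.
by rewrite ler0_norm ?subr_le0 // opprB.
Qed.

(** The integrating factor [expR (- c * t)] reduces the claim to monotonicity. Nonnegativity of [g]
    lets [1 + c * h <= expR (c * h)] be multiplied by [g t], whatever the sign of [c]. *)
Lemma ae_gronwall (g : R -> R) b c : 0 <= b -> real_abs_cont 0 b g ->
  {ae mu, forall t, 0 <= t -> t < b -> forall eps, 0 < eps ->
    exists2 h0, 0 < h0 & forall h, 0 < h -> h < h0 -> t + h <= b ->
      g (t + h) <= g t + h * (c * g t + eps)} ->
  (forall t, 0 <= t -> t <= b -> 0 <= g t) ->
  g b <= expR (c * b) * g 0.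
Proof.
move=> b0 gac gdini g0.
suff : expR (- c * b) * g b <= expR (- c * 0) * g 0.
  rewrite mulr0 expR0 mul1r => /(ler_wpM2l (expR_ge0 (c * b))).
  by rewrite mulrA -expRD mulNr subrr expR0 mul1r.
have [t|s t u|B B0 gB] := small_incr_bounded _ _ gac.
- by rewrite subrr normr0.
- by rewrite [leRHS]addrC; exact: ler_distD.
apply: (@real_abs_cont_nonincr 0 b (fun t => expR (- c * t) * g t)) => //.
  pose A := expR (`|- c| * b).
  have A0 : 0 < A by exact: expR_gt0.
  pose B' := B + `|g 0|.
  (* Product rule for increments: [A] bounds the exponential, [A] times the modulus of [c] is its
     Lipschitz constant, and [B'] bounds [g]. *)
  have C0 : 0 < A + A * `|- c| * B'.
    by rewrite ltr_wpDr // !mulr_ge0 ?addr_ge0 // ltW.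
  apply: small_incr_dominated C0 _ gac => s t s0 st tb.
  have -> : expR (- c * t) * g t - expR (- c * s) * g s =
      expR (- c * t) * (g t - g s) + (expR (- c * t) - expR (- c * s)) * g s by ring.
  apply: le_trans (ler_normD _ _) _; rewrite !normrM.
  have h1 : `|expR (- c * t)| <= A.
    rewrite ger0_norm ?expR_ge0 // ler_expR; apply: le_trans (ler_norm _) _.
    by rewrite normrM ler_wpM2l // ger0_norm // (le_trans s0).
  have h2 := expR_lipschitz_on (- c) s0 st tb; rewrite -/A in h2.
  have h3 : `|g s| <= B'.
    rewrite -[g s](subrK (g 0)); apply: le_trans (ler_normD _ _) _.
    by rewrite lerD2r gB // (le_trans st).
  have h4 : `|expR (- c * t)| * `|g t - g s| <= A * `|g t - g s| by rewrite ler_wpM2r.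
  have h5 := ler_pM (normr_ge0 _) (normr_ge0 _) h2 h3.
  have : 0 <= A * `|- c| * B' * `|g t - g s|.
    by rewrite !mulr_ge0 ?addr_ge0 // ltW.
  have : 0 <= A * (t - s) by rewrite mulr_ge0 ?subr_ge0 // ltW.
  by lra.
apply: ae_lebesgueS gdini => t ht t0 tb eps eps0.
pose A := expR (`|- c| * b).
have A0 : 0 < A by exact: expR_gt0.
(* The error gets multiplied by an exponential of size at most [A], so it is requested as
   [eps / A]. *)
have [h0 h00 hh] := ht t0 tb (eps / A) (divr_gt0 eps0 A0).
pose h := Num.min (h0 / 2) (b - t).
have hpos : 0 < h by rewrite lt_min divr_gt0 //= subr_gt0.
have thb : t + h <= b by rewrite -lerBrDl ge_min lexx orbT.
have hlt : h < h0.
  by apply: (@le_lt_trans _ _ (h0 / 2)); rewrite ?ge_min ?lexx //; lra.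
exists h => //; split=> //.
have g1 := hh h hpos hlt thb.
have gt0 := g0 t t0 (ltW tb).
apply: le_trans (ler_wpM2l (expR_ge0 _) g1) _.
have -> : g t + h * (c * g t + eps / A) = (1 + c * h) * g t + h * (eps / A) by ring.
rewrite mulrDr; apply: lerD.
  rewrite mulrA; apply: ler_wpM2r => //.
  apply: (@le_trans _ _ (expR (- c * (t + h)) * expR (c * h))).
    by rewrite ler_wpM2l ?expR_ge0 // expR_ge1Dx.
  by rewrite -expRD ler_expR; lra.
apply: (@le_trans _ _ (A * (h * (eps / A)))).
  apply: ler_wpM2r; first by rewrite mulr_ge0 ?divr_ge0 // ltW.
  rewrite ler_expR; apply: le_trans (ler_norm _) _.
  by rewrite normrM ler_wpM2l // ger0_norm // addr_ge0 // ltW.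
by rewrite mulrCA (mulrC A) divfK ?gt_eqF // mulrC.
Qed.

End AbsolutelyContinuous.

(** * Projections on closed convex sets *)

Section Projection.
Context {R : realType} {n : nat}.
Implicit Types (u v w x y z : 'cV[R]_n) (Q A : 'M[R]_n) (S : set 'cV[R]_n).

Lemma wnorm_ge0 Q u : 0 <= wnorm Q u. Proof. exact: sqrtr_ge0. Qed.

Lemma sqr_wnorm Q u : spd Q -> wnorm Q u ^+ 2 = dot u (Q *m u).
Proof. by move=> sQ; rewrite sqr_sqrtr // spd_ge0. Qed.

Lemma dot_le_wnorm Q u v : spd Q -> dot u (Q *m v) <= wnorm Q u * wnorm Q v.
Proof.
move=> sQ; apply: le_trans (ler_norm _) _.
rewrite -ler_sqr ?nnegrE ?mulr_ge0 ?wnorm_ge0 ?normr_ge0 //.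
by rewrite real_normK ?num_real // exprMn !sqr_wnorm // spd_CauchySchwarz.
Qed.

Lemma ler_wnormD Q u v : spd Q -> wnorm Q (u + v) <= wnorm Q u + wnorm Q v.
Proof.
move=> sQ; rewrite -ler_sqr ?nnegrE ?addr_ge0 ?wnorm_ge0 //.
rewrite sqrrD !sqr_wnorm // mulmxDr !dot_lin (dot_sym v u (proj1 sQ)).
have := dot_le_wnorm u v sQ; lra.
Qed.

Lemma wnorm_le_enorm Q a u : opnorm Q <= a -> wnorm Q u <= Num.sqrt a * enorm u.
Proof.
move=> Qa; rewrite /wnorm /enorm -sqrtrM.
  by apply: ler_wsqrtr; exact: dot_opnorm_le.
exact: le_trans (opnorm_ge0 Q) Qa.
Qed.

Lemma enorm_le_wnorm A a u : 0 <= a -> spd A -> opnorm A <= a ->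
  enorm u <= Num.sqrt a * wnorm (invmx A) u.
Proof.
move=> a0 sA Aa; rewrite /wnorm /enorm -sqrtrM //.
by apply: ler_wsqrtr; exact: dot_le_inv.
Qed.

Lemma cauchy_limit (u : nat -> 'cV[R]_n) :
  (forall e, 0 < e -> exists N, forall k l, (N <= k)%N -> (N <= l)%N ->
    enorm (u k - u l) < e) ->
  exists l, forall e, 0 < e -> exists N, forall k, (N <= k)%N ->
    enorm (u k - l) < e.
Proof.
move=> uc; have : cvg (u @ \oo).
  apply/cauchy_cvgP/cauchyP => e e0; have [N hN] := uc e e0.
  exists (u N), N => // k /= Nk; rewrite -ball_normE /=.
  by apply: le_lt_trans (normr_le_enorm _) _; exact: hN.
move=> ul; exists (lim (u @ \oo)) => e e0.
(* Taking [n.+1] rather than [n] keeps the divisor positive in dimension 0. *)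
have n0 : 0 < n.+1%:R :> R by [].
have /cvgrPdist_lt/(_ _ (divr_gt0 e0 n0))[N _ hN] := ul.
exists N => k /hN /= h; apply: le_lt_trans (enorm_le_normr _) _.
rewrite distrC in h; apply: (@le_lt_trans _ _ (n.+1%:R * `|u k - lim (u @ \oo)|)).
  by rewrite ler_wpM2r // ler_nat.
by rewrite mulrC -ltr_pdivlMr.
Qed.

Lemma closed_limit S l : closed S ->
  (forall e, 0 < e -> exists2 s, S s & enorm (s - l) < e) -> S l.
Proof.
move=> Sc h; apply: Sc => B /nbhs_ballP[e /= e0 eB].
have [s Ss sl] := h e e0; exists s; split=> //; apply: eB.
by rewrite -ball_normE /= distrC (le_lt_trans (normr_le_enorm _)).
Qed.

Lemma convex_segment S x y (t : R) : convex_set S -> S x -> S y ->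
  0 <= t -> t <= 1 -> S (x + t *: (y - x)).
Proof.
move=> Sc Sx Sy t0 t1.
have := Sc y x (Itv01 t0 t1); rewrite !inE => /(_ Sy Sx).
have -> // : x + t *: (y - x) = t *: y + (1 - t) *: x.
by rewrite scalerBr scalerBl scale1r addrCA.
Qed.

(** A minimizing sequence is Cauchy: midpoints stay in the convex set and cannot beat the infimum,
    so the parallelogram identity bounds the distance of two late terms. *)
Lemma argmin_wnorm_exists S Q y : S !=set0 -> closed S -> convex_set S ->
  spd Q -> exists p, argmin S (fun z => 2^-1 * wnorm Q (z - y) ^+ 2) p.
Proof.
move=> [s0 Ss0] Sc Sv sQ.
pose W z := wnorm Q (z - y).
pose D := [set W z | z in S].
have D0 : has_inf D.
  by split; [exists (W s0), s0|exists 0 => _ [z _ <-]; exact: wnorm_ge0].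
pose d := inf D.
have dW z : S z -> d <= W z by move=> Sz; apply: ge_inf; [case: D0|exists z].
have d0 : 0 <= d.
  by apply: lb_le_inf; [case: D0|move=> _ [z _ <-]; exact: wnorm_ge0].
have /choice[u hu] : forall k : nat, exists z, S z /\ W z < d + k.+1%:R^-1.
  move=> k; have k0 : 0 < k.+1%:R^-1 :> R by rewrite invr_gt0.
  by have [_ [z Sz <-] hz] := inf_adherent k0 D0; exists z.
pose c := opnorm (invmx Q).
(* With [e = N.+1%:R^-1 <= 1] the identity leaves at most [4 * (d + e) ^ 2 - 4 * d ^ 2 = 8 * d * e +
   4 * e ^ 2 <= (8 * d + 4) * e]; the factor from [c] converts back to the Euclidean norm. *)
have parallelogram k l N : (N <= k)%N -> (N <= l)%N ->
    enorm (u k - u l) ^+ 2 <= `|c| * ((8 * d + 4) * N.+1%:R^-1).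
  move=> Nk Nl; have [Sk Wk] := hu k; have [Sl Wl] := hu l.
  have N0 : 0 < N.+1%:R^-1 :> R by rewrite invr_gt0.
  have N1 : N.+1%:R^-1 <= 1 :> R by rewrite invf_le1 // ler1n.
  have hk : W (u k) <= d + N.+1%:R^-1.
    by apply/ltW/(lt_le_trans Wk); rewrite lerD2l lef_pV2 ?posrE // ler_nat.
  have hl : W (u l) <= d + N.+1%:R^-1.
    by apply/ltW/(lt_le_trans Wl); rewrite lerD2l lef_pV2 ?posrE // ler_nat.
  have hm : d <= W (u k + 2^-1 *: (u l - u k)).
    by apply: dW; apply: convex_segment => //; lra.
  have := dot_le_inv (u k - u l) (spd_inv sQ) (ler_norm c).
  rewrite invmxK -sqr_enorm => /le_trans; apply; apply: ler_wpM2l => //.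
  have -> : dot (u k - u l) (Q *m (u k - u l)) =
      2 * W (u k) ^+ 2 + 2 * W (u l) ^+ 2
        - 4 * W (u k + 2^-1 *: (u l - u k)) ^+ 2.
    rewrite /W !sqr_wnorm //.
    have -> : u k + 2^-1 *: (u l - u k) - y =
        2^-1 *: (u k - y) + 2^-1 *: (u l - y).
      by apply/matrixP => i j; rewrite !mxE; field.
    have -> : u k - u l = (u k - y) - (u l - y) by rewrite opprB addrA subrK.
    move: (u k - y) (u l - y) => a b.
    rewrite !(mulmxBr, mulmxDr, =^~ scalemxAr) !dot_lin.
    by rewrite (dot_sym b a (proj1 sQ)); field.
  have := wnorm_ge0 Q (u k - y); have := wnorm_ge0 Q (u l - y).
  rewrite -/(W _) -/(W _) => l0 k0.
  have : W (u k) ^+ 2 <= (d + N.+1%:R^-1) ^+ 2 by rewrite ler_sqr ?nnegrE ?addr_ge0 // ltW.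
  have : W (u l) ^+ 2 <= (d + N.+1%:R^-1) ^+ 2 by rewrite ler_sqr ?nnegrE ?addr_ge0 // ltW.
  have : d ^+ 2 <= W (u k + 2^-1 *: (u l - u k)) ^+ 2 by rewrite ler_sqr ?nnegrE ?wnorm_ge0.
  have : N.+1%:R^-1 ^+ 2 <= N.+1%:R^-1 :> R by rewrite expr2 ler_piMr // ltW.
  move: (N.+1%:R^-1 : R) => e; lra.
have [|p hp] := @cauchy_limit u.
  move=> e e0.
  have C0 : 0 < (`|c| + 1) * (8 * d + 4).
    by have := normr_ge0 c; move=> ?; apply: mulr_gt0; lra.
  have := archi_boundP (ltW (divr_gt0 C0 (exprn_gt0 2 e0))).
  set N := Num.bound _ => hN.
  exists N => k l Nk Nl.
  rewrite -ltr_sqr ?nnegrE ?enorm_ge0 ?(ltW e0) //.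
  apply: le_lt_trans (parallelogram _ _ _ Nk Nl) _.
  apply: (@le_lt_trans _ _ ((`|c| + 1) * ((8 * d + 4) * N.+1%:R^-1))).
    by rewrite ler_wpM2r ?lerDl // mulr_ge0 // addr_ge0 // mulr_ge0.
  rewrite mulrA ltr_pdivrMr // [ltRHS]mulrC -ltr_pdivrMr ?exprn_gt0 //.
  by apply: lt_le_trans hN _; rewrite ler_nat.
exists p.
have Sp : S p.
  apply: closed_limit => // e /hp[N hN]; exists (u N); last exact: hN.
  by have [] := hu N.
split=> // w Sw; rewrite ler_pM2l ?invr_gt0 // ler_sqr ?nnegrE ?wnorm_ge0 //.
apply: le_trans (dW _ Sw).
(* Half of [e] pays for the distance from [p] to [u k], the other half for the excess of [W (u k)]
   over [d]. *)
apply/ler_addgt0Pr => e e0.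
have b0 : 0 < Num.sqrt (opnorm Q) + 1 by rewrite ltr_wpDl.
have e20 : 0 < e / 2 by rewrite divr_gt0.
have [N hN] := hp _ (divr_gt0 e20 b0).
have := archi_boundP (ltW (divr_gt0 ltr01 e20)); set N' := Num.bound _ => hN'.
pose k := maxn N N'.
have [_ Wk] := hu k.
have h1 : W p <= W (u k) + wnorm Q (p - u k).
  rewrite /W; have -> : p - y = (u k - y) + (p - u k) by rewrite [RHS]addrC subrKA.
  exact: ler_wnormD.
have h2 : wnorm Q (p - u k) <= e / 2.
  apply: le_trans (wnorm_le_enorm _ (lexx _)) _; rewrite enormC.
  apply: (@le_trans _ _ ((Num.sqrt (opnorm Q) + 1) * enorm (u k - p))).
    by rewrite ler_wpM2r ?enorm_ge0 ?lerDl.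
  by rewrite mulrC -ler_pdivlMr //; apply/ltW/hN; rewrite leq_maxl.
have h3 : k.+1%:R^-1 <= e / 2.
  rewrite -(invrK (e / 2)) lef_pV2 ?posrE ?invr_gt0 // -div1r.
  by apply/ltW/(lt_le_trans hN'); rewrite ler_nat leqW // leq_maxr.
rewrite -/(W p) [e in _ <= _ + e]splitr addrA.
by apply: le_trans h1 _; apply: lerD h2; apply/ltW/(lt_le_trans Wk); rewrite lerD2l.
Qed.

Lemma projP S Q y : S !=set0 -> closed S -> convex_set S -> spd Q ->
  argmin S (fun z => 2^-1 * wnorm Q (z - y) ^+ 2) (Defs.proj S Q y).
Proof.
by move=> S0 Sc Sv sQ; apply: xgetPex; exact: argmin_wnorm_exists.
Qed.

Lemma proj_mem S Q y : S !=set0 -> closed S -> convex_set S -> spd Q ->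
  S (Defs.proj S Q y).
Proof. by move=> S0 Sc Sv sQ; have [] := projP y S0 Sc Sv sQ. Qed.

Lemma proj_variational S Q y w : S !=set0 -> closed S -> convex_set S ->
  spd Q -> S w ->
  0 <= dot (w - Defs.proj S Q y) (Q *m (Defs.proj S Q y - y)).
Proof.
move=> S0 Sc Sv sQ Sw; have [Sp hp] := projP y S0 Sc Sv sQ.
set p := Defs.proj S Q y in Sp hp *; set X := dot _ _; rewrite leNgt; apply/negP => X0.
pose q := dot (w - p) (Q *m (w - p)).
have q0 : 0 <= q by exact: spd_ge0.
have step t : 0 <= t -> t <= 1 -> 0 <= 2 * t * X + t ^+ 2 * q.
  move=> t0 t1; have := hp _ (convex_segment Sv Sp Sw t0 t1).
  rewrite ler_pM2l ?invr_gt0 // !sqr_wnorm // addrAC.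
  move: @X @q X0 q0; move: (w - p) (p - y) => a b X q X0 q0.
  rewrite !(mulmxDr, =^~ scalemxAr) !dot_lin (dot_sym b a (proj1 sQ)).
  by rewrite -/X -/q; lra.
have : 0 < 1 - X + q by lra.
(* This [t] satisfies [t * q < - X], hence [2 * t * X + t ^ 2 * q < t * X < 0], and the denominator
   exceeds [- X], which keeps [t] below 1. *)
pose t := - X / (1 - X + q); move=> D0.
have t0 : 0 < t by rewrite divr_gt0 // oppr_gt0.
have tX : t * (1 - X + q) = - X by rewrite /t divfK // gt_eqF.
have t1 : t <= 1 by rewrite ler_pdivrMr //; lra.
have := step t (ltW t0) t1; rewrite leNgt => /negP; apply.
by nra.
Qed.

Lemma proj_self S Q y : S !=set0 -> closed S -> convex_set S -> spd Q ->
  S y -> Defs.proj S Q y = y.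
Proof.
move=> S0 Sc Sv sQ Sy; have := proj_variational y S0 Sc Sv sQ Sy.
rewrite -opprB dotNl oppr_ge0 => h; apply/eqP; rewrite -subr_eq0.
by apply: contraTT h => /(proj2 sQ); rewrite -ltNge.
Qed.

Lemma proj1_nonexpansive S x y : S !=set0 -> closed S -> convex_set S ->
  enorm (Defs.proj S 1%:M x - Defs.proj S 1%:M y) <= enorm (x - y).
Proof.
move=> S0 Sc Sv; set p := Defs.proj S _ x; set q := Defs.proj S _ y.
have := proj_variational x S0 Sc Sv spd1 (proj_mem y S0 Sc Sv spd1).
have := proj_variational y S0 Sc Sv spd1 (proj_mem x S0 Sc Sv spd1).
rewrite -/p -/q !mul1mx => h1 h2; clearbody p q.
have h : enorm (p - q) ^+ 2 <= enorm (p - q) * enorm (x - y).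
  apply: le_trans (dot_le (p - q) (x - y)); rewrite sqr_enorm.
  move: h1 h2; rewrite !dot_lin (dotC q p) (dotC q x) (dotC q y); lra.
have [->|/eqP] := eqVneq (enorm (p - q)) 0; first exact: enorm_ge0.
move=> /eqP pq0; have pq : 0 < enorm (p - q) by rewrite lt_neqAle eq_sym pq0 enorm_ge0.
by rewrite -(ler_pM2l pq) -expr2.
Qed.

End Projection.

(** * Absolutely continuous curves *)

Section Curves.
Context {R : realType} {n : nat}.
Implicit Types (x y : R -> 'cV[R]_n) (w p : 'cV[R]_n) (S A : set 'cV[R]_n).
Local Notation mu := (@lebesgue_measure R).

(** Trajectories enter the increment estimates only through this right-hand first-order
    expansion. *)
Lemma is_derive_enorm x (t : R) w :
  is_derive (t : R^o) (1 : R^o) (x : R^o -> 'cV[R]_n) w ->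
  forall eps, 0 < eps -> exists2 h0, 0 < h0 & forall h, 0 < h -> h < h0 ->
    enorm (x (t + h) - x t - h *: w) <= eps * h.
Proof.
move=> [dx xw] eps eps0.
have n0 : 0 < n.+1%:R :> R by [].
have /cvgrPdist_le/(_ _ (divr_gt0 eps0 n0))[h0 /= h00 hh] :
  h^-1 *: (((x : R^o -> 'cV[R]_n) \o shift t) (h *: (1 : R^o)) - x t) @[h --> 0^'] --> w.
  by rewrite -xw; exact: dx.
exists h0 => // h hpos hlt.
have := hh h; rewrite /= sub0r normrN gtr0_norm // => /(_ hlt).
rewrite gt_eqF // => /(_ isT); rewrite [h%:A]mulr1 [h + t]addrC distrC => hq.
have -> : x (t + h) - x t - h *: w = h *: (h^-1 *: (x (t + h) - x t) - w).
  by rewrite scalerBr scalerA divff ?gt_eqF // scale1r.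
rewrite enormZ gtr0_norm // mulrC ler_wpM2r ?(ltW hpos) //.
apply: le_trans (enorm_le_normr _) _.
apply: (@le_trans _ _ (n.+1%:R * `|h^-1 *: (x (t + h) - x t) - w|)).
  by rewrite ler_wpM2r // ler_nat.
by rewrite mulrC -ler_pdivlMr.
Qed.

Lemma abs_cont_bounded (b : R) x p : 0 <= b -> abs_cont 0 b x ->
  exists2 B, 0 <= B & forall t, 0 <= t -> t <= b -> enorm (x t - p) <= B.
Proof.
move=> b0 xac.
have [t|s t u|B B0 hB] :=
  @small_incr_bounded R 0 b (fun s t => enorm (x t - x s)) _ _ xac.
- by rewrite subrr enorm0.
- by rewrite [leRHS]addrC; exact: ler_enorm_distD.
exists (B + enorm (x 0 - p)) => [|t t0 tb]; first by rewrite addr_ge0 ?enorm_ge0.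
apply: le_trans (ler_enorm_distD (x 0) _ _) _; rewrite lerD2r; exact: hB.
Qed.

Lemma lipschitz_abs_cont (c d C : R) x : 0 < C ->
  (forall s t, c <= s -> s <= t -> t <= d -> enorm (x t - x s) <= C * (t - s)) ->
  abs_cont c d x.
Proof.
move=> C0 xC; apply: (@small_incr_dominated R c d (fun s t => 0)
  (fun s t => enorm (x t - x s)) C C0) => [s t *|eps eps0].
  by rewrite add0r; exact: xC.
by exists 1 => // k a b _ _ _; rewrite big1.
Qed.

Lemma abs_cont_enormB (b : R) x y : abs_cont 0 b x -> abs_cont 0 b y ->
  real_abs_cont 0 b (fun t => enorm (x t - y t)).
Proof.
move=> xac yac; apply: (@small_incr_dominated R 0 b
  (fun s t => enorm (x t - x s) + enorm (y t - y s)) _ 1 ltr01 _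
  (small_incrD xac yac)) => s t _ st _.
rewrite mul1r; apply: (@le_trans _ _ (enorm (x t - x s) + enorm (y t - y s)));
  last by rewrite /= lerDl subr_ge0.
have tri (p q : 'cV[R]_n) : `|enorm p - enorm q| <= enorm (p - q).
  have := ler_enormD (p - q) q; have := ler_enormD (q - p) p.
  by rewrite !subrK (enormC q) ler_norml; lra.
apply: le_trans (tri _ _) _.
have -> : x t - y t - (x s - y s) = (x t - x s) - (y t - y s).
  by rewrite !opprB addrACA [RHS]addrACA; congr (_ + _); rewrite addrC.
exact: ler_enormB.
Qed.

(** Gronwall for the distance of the two curves, which starts at 0. The Lipschitz bound is asked on
    a set [A] containing both curves, since for the flow it is available only on bounded parts of
    [S]. *)
Lemma ode_unique A (f : 'cV[R]_n -> 'cV[R]_n) (Lam b : R) x y : 0 <= b ->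
  (forall p q, A p -> A q -> enorm (f p - f q) <= Lam * enorm (p - q)) ->
  (forall t, 0 <= t -> t <= b -> A (x t)) ->
  (forall t, 0 <= t -> t <= b -> A (y t)) ->
  abs_cont 0 b x -> abs_cont 0 b y ->
  {ae mu, forall t, 0 <= t -> t < b ->
    is_derive (t : R^o) (1 : R^o) (x : R^o -> 'cV[R]_n) (f (x t))} ->
  {ae mu, forall t, 0 <= t -> t < b ->
    is_derive (t : R^o) (1 : R^o) (y : R^o -> 'cV[R]_n) (f (y t))} ->
  x 0 = y 0 -> x b = y b.
Proof.
move=> b0 fL Ax Ay xac yac dx dy xy0.
have := @ae_gronwall R (fun t => enorm (x t - y t)) b Lam b0
  (abs_cont_enormB xac yac).
rewrite xy0 subrr enorm0 mulr0 => h.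
have : enorm (x b - y b) <= 0.
  apply: h => [|t _ _]; last exact: enorm_ge0.
  apply: ae_lebesgueS2 dx dy => t dx dy t0 tb eps eps0.
  have e0 : 0 < eps / 2 by rewrite divr_gt0.
  have [h1 h10 hx] := is_derive_enorm (dx t0 tb) e0.
  have [h2 h20 hy] := is_derive_enorm (dy t0 tb) e0.
  exists (Num.min h1 h2) => [|h hpos]; first by rewrite lt_min h10.
  rewrite lt_min => /andP[/(hx _ hpos) {}hx /(hy _ hpos) {}hy] _.
  have -> : x (t + h) - y (t + h) = (x t - y t) + h *: (f (x t) - f (y t))
     + ((x (t + h) - x t - h *: f (x t)) - (y (t + h) - y t - h *: f (y t))).
    by apply/matrixP => i j; rewrite !mxE; ring.
  apply: le_trans (ler_enormD _ _) _.
  have := ler_enormD (x t - y t) (h *: (f (x t) - f (y t))).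
  have := ler_enormB (x (t + h) - x t - h *: f (x t)) (y (t + h) - y t - h *: f (y t)).
  have := fL _ _ (Ax t t0 (ltW tb)) (Ay t t0 (ltW tb)).
  rewrite enormZ gtr0_norm // => /(ler_wpM2l (ltW hpos)); lra.
rewrite le_eqVlt ltNge enorm_ge0 orbF enorm_eq0 subr_eq0.
by move=> /eqP.
Qed.

(* The distance to [S] does not increase: moving towards [g (x t)] from [x t],
   compare with moving towards [g (x t)] from the projection of [x t] on [S]. *)
Lemma convex_flow_invariant S (g : 'cV[R]_n -> 'cV[R]_n) (lambda b : R) x :
  0 <= b -> 0 < lambda -> closed S -> convex_set S -> (forall p, S (g p)) ->
  abs_cont 0 b x ->
  {ae mu, forall t, 0 <= t -> t < b -> is_derive (t : R^o) (1 : R^o)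
     (x : R^o -> 'cV[R]_n) (lambda *: (g (x t) - x t))} ->
  S (x 0) -> S (x b).
Proof.
move=> b0 lambda0 Sc Sv Sg xac dx Sx0.
have S0 : S !=set0 by exists (x 0).
pose P := Defs.proj S 1%:M.
have PS p : S (P p) by apply: proj_mem => //; exact: spd1.
have Pmin p q : S q -> enorm (p - P p) <= enorm (p - q).
  move=> Sq; have [_ /(_ q Sq)] := projP p S0 Sc Sv spd1.
  rewrite -/(P p) ler_pM2l ?invr_gt0 // !sqr_wnorm ?spd1 //; last 2 first.
  - exact: spd1.
  - exact: spd1.
  rewrite !mul1mx -!sqr_enorm ler_sqr ?nnegrE ?enorm_ge0 //.
  by rewrite enormC (enormC q).
have Plip p q : enorm (P p - P q) <= enorm (p - q) by exact: proj1_nonexpansive.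
have : enorm (x b - P (x b)) <= enorm (x 0 - P (x 0)).
  apply: (@real_abs_cont_nonincr R 0 b (fun t => enorm (x t - P (x t)))) => //.
    apply: abs_cont_enormB => //.
    apply: (@small_incr_dominated R 0 b (fun s t => enorm (x t - x s))
      (fun s t => enorm (P (x t) - P (x s))) 1 ltr01 _ xac) => s t _ st _.
    by rewrite mul1r (le_trans (Plip _ _)) // lerDl subr_ge0.
  apply: ae_lebesgueS dx => t dx t0 tb eps eps0.
  have [h0 h00 hx] := is_derive_enorm (dx t0 tb) eps0.
  (* The bound by [lambda^-1] makes [h * lambda] a convex weight, so that [z] below lies in [S]. *)
  pose h := Num.min (h0 / 2) (Num.min (b - t) lambda^-1).
  have hpos : 0 < h by rewrite !lt_min divr_gt0 //= subr_gt0 tb invr_gt0.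
  have hb : h <= b - t by rewrite /h !ge_min lexx !orbT.
  have hl : h <= lambda^-1 by rewrite /h !ge_min lexx !orbT.
  have hh0 : h < h0.
    by apply: (@le_lt_trans _ _ (h0 / 2)); rewrite ?ge_min ?lexx //; lra.
  exists h => //; split; first by rewrite -lerBrDl.
  have hl1 : h * lambda <= 1 by rewrite -ler_pdivlMr // div1r.
  pose z := P (x t) + (h * lambda) *: (g (x t) - P (x t)).
  have Sz : S z by apply: convex_segment => //; rewrite mulr_ge0 // ltW.
  apply: le_trans (Pmin _ _ Sz) _.
  have -> : x (t + h) - z = (1 - h * lambda) *: (x t - P (x t))
      + (x (t + h) - x t - h *: (lambda *: (g (x t) - x t))).
    by rewrite /z; apply/matrixP => i j; rewrite !mxE; ring.
  apply: le_trans (ler_enormD _ _) _; apply: lerD (hx _ hpos hh0).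
  rewrite enormZ ger0_norm ?subr_ge0 // ler_piMl ?enorm_ge0 // gerBl.
  by rewrite mulr_ge0 // ltW.
have -> : P (x 0) = x 0 by apply: proj_self => //; exact: spd1.
rewrite subrr enorm0 le_eqVlt ltNge enorm_ge0 orbF enorm_eq0 subr_eq0 => /eqP ->.
exact: PS.
Qed.

End Curves.

(** * Picard iteration *)

Section Picard.
Context {R : realType}.
Implicit Types (f g h phi : R -> R).
Local Notation mu := (@lebesgue_measure R).

(** Integrating from -1 makes 0 an interior point; the continuity of the Picard iterates at 0 relies
    on differentiability there. *)
Lemma continuous_antiderivative g : continuous (g : R^o -> R^o) ->
  exists G : R -> R, G 0 = 0 /\ forall t, -1 < t ->
    is_derive (t : R^o) (1 : R^o) (G : R^o -> R^o) (g t).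
Proof.
move=> gc; pose I x := (\int[mu]_(s in `[(-1 : R), x]) g s)%R.
have dI t : -1 < t -> is_derive (t : R^o) (1 : R^o) (I : R^o -> R^o) (g t).
  move=> t1; have tt1 : t < t + 1 by rewrite ltrDl.
  have [|//||dG Gg] := @continuous_FTC1_closed R g (-1) t (t + 1) tt1.
  - apply: continuous_compact_integrable; first exact: segment_compact.
    by apply: continuous_subspaceT => s; exact: gc.
  - exact: gc.
  by split; [exact: dG|rewrite -derive1E].
exists (fun t => I t - I 0); split=> [|t t1]; first by rewrite subrr.
have dIt := dI t t1.
have := is_deriveB dIt (is_derive_cst (I 0 : R^o) (t : R^o) (1 : R^o)).
by rewrite subr0.
Qed.

(** The mean value theorem for [phi - f] and for [phi + f]. *)
Lemma is_derive_increment_le f phi (df dphi : R -> R) (a b : R) : a <= b ->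
  {within `[a, b], continuous (f : R^o -> R^o)} ->
  {within `[a, b], continuous (phi : R^o -> R^o)} ->
  (forall t, a < t -> t < b ->
    is_derive (t : R^o) (1 : R^o) (f : R^o -> R^o) (df t)) ->
  (forall t, a < t -> t < b ->
    is_derive (t : R^o) (1 : R^o) (phi : R^o -> R^o) (dphi t)) ->
  (forall t, a < t -> t < b -> `|df t| <= dphi t) ->
  `|f b - f a| <= phi b - phi a.
Proof.
rewrite le_eqVlt => /predU1P[->|ab]; first by rewrite !subrr normr0.
move=> fc pc fd pd le_d.
have key (c : R) : c = 1 \/ c = -1 -> c * (f b - f a) <= phi b - phi a.
  move=> c1.
  have [t||t] := @MVT R (fun t => phi t - c * f t) (fun t => dphi t - c * df t) a b ab.
  - rewrite in_itv /= => /andP[at_ tb].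
    have h1 := fd t at_ tb; have h2 := pd t at_ tb.
    exact: (is_deriveB h2 (is_deriveZ c h1)).
  - move=> t; apply: cvgB; first exact: pc.
    by apply: cvgM; [exact: cvg_cst|exact: fc].
  - rewrite in_itv /= => /andP[at_ tb] h.
    have := le_d t at_ tb; rewrite ler_norml => /andP[d1 d2].
    have : 0 <= (dphi t - c * df t) * (b - a).
      by rewrite mulr_ge0 ?subr_ge0 ?(ltW ab) //; case: c1 => ->; lra.
    by rewrite -h; lra.
have h1 := key 1 (or_introl erefl); have h2 := key (-1) (or_intror erefl).
by rewrite ler_norml; lra.
Qed.

Context {n : nat}.
Implicit Types (x y z : R -> 'cV[R]_n).

Lemma continuous_coord z i : continuous z -> continuous (fun t => z t i 0).
Proof.
move=> zc t; apply: (@continuous_comp _ _ _ z (fun u : 'cV[R]_n => u i 0)).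
  exact: zc.
exact: coord_continuous.
Qed.

Lemma coord_continuous_vec z :
  (forall i, continuous (fun t => z t i 0)) -> continuous z.
Proof.
move=> zc t; apply/cvgrPdist_le => e e0; near=> s.
rewrite [leLHS]/Num.Def.normr /= mx_normrE.
apply: bigmax_le => [|[i j] _]; first exact: ltW.
rewrite !mxE /= (ord1 j); move: i; near: s; apply: filter_forall => i.
exact: (cvgrPdist_le _ _).1 (zc i t) _ e0.
Unshelve. all: by end_near. Qed.

Lemma is_derive_coord z (t : R) (w : 'cV[R]_n) i :
  is_derive (t : R^o) (1 : R^o) (z : R^o -> 'cV[R]_n) w ->
  is_derive (t : R^o) (1 : R^o) ((fun s => z s i 0) : R^o -> R^o) (w i 0).
Proof.
move=> [dz zw]; split; first exact: (derivable_mxP _ _ _).1 dz i 0.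
by rewrite -zw derive_mx // mxE.
Qed.

Lemma is_derive_vec z (t : R) (w : 'cV[R]_n) :
  (forall i,
    is_derive (t : R^o) (1 : R^o) ((fun s => z s i 0) : R^o -> R^o) (w i 0)) ->
  is_derive (t : R^o) (1 : R^o) (z : R^o -> 'cV[R]_n) w.
Proof.
move=> dz; have der : derivable (z : R^o -> 'cV[R]_n) t 1.
  by apply/derivable_mxP => i j; rewrite (ord1 j); case: (dz i).
split=> //; rewrite derive_mx //; apply/matrixP => i j; rewrite mxE (ord1 j).
by case: (dz i).
Qed.

Lemma vec_norm_le (u : 'cV[R]_n) c : 0 <= c -> (forall i, `|u i 0| <= c) -> `|u| <= c.
Proof.
move=> c0 uc; rewrite [leLHS]/Num.Def.normr /= mx_normrE.
by apply: bigmax_le => // -[i j] _; rewrite (ord1 j) /= uc.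
Qed.

(** The sup norm reduces this to coordinates, which is why Picard iteration is run in that norm. The
    hypothesis [phi a <= phi b] gives the sign of the bound in dimension 0, where no coordinate
    can. *)
Lemma vec_increment_le z phi (dz : R -> 'cV[R]_n) (dphi : R -> R) (a b : R) :
  a <= b -> continuous z -> continuous phi ->
  (forall t, a < t -> t < b ->
    is_derive (t : R^o) (1 : R^o) (z : R^o -> 'cV[R]_n) (dz t)) ->
  (forall t, a < t -> t < b ->
    is_derive (t : R^o) (1 : R^o) (phi : R^o -> R^o) (dphi t)) ->
  (forall t, a < t -> t < b -> `|dz t| <= dphi t) ->
  phi a <= phi b ->
  `|z b - z a| <= phi b - phi a.
Proof.
move=> ab zc pc zd pd le_d pab; apply: vec_norm_le => [|i]; first by rewrite subr_ge0.
rewrite !mxE; apply: (@is_derive_increment_le (fun t => z t i 0) phi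
  (fun t => dz t i 0) dphi) => //.
- by apply: continuous_subspaceT => t; exact: continuous_coord.
- by apply: continuous_subspaceT => t; exact: pc.
- by move=> t at_ tb; apply: is_derive_coord; exact: zd.
- move=> t at_ tb; exact: le_trans (coord_le_normr _ _) (le_d t at_ tb).
Qed.

Lemma is_derive_expR_scale (c A t : R) :
  is_derive (t : R^o) (1 : R^o) ((fun s => A * expR (c * s)) : R^o -> R^o)
    (A * (c * expR (c * t))).
Proof.
have h : is_derive (t : R^o) (1 : R^o) ((fun s : R => c * s) : R^o -> R^o) c.
  have := is_deriveZ c (is_derive_id (t : R^o) (1 : R^o)).
  by rewrite /GRing.scale /= mulr1.
have h2 := is_deriveZ A (is_derive1_comp (is_derive_expR (c * t)) h).
by apply: is_derive_eq h2 _; rewrite /GRing.scale /= (mulrC (expR _)).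
Qed.

Section Iteration.
Variables (f : 'cV[R]_n -> 'cV[R]_n) (Lam : R) (x0 : 'cV[R]_n).
Hypotheses (Lam0 : 0 < Lam) (fL : forall p q, `|f p - f q| <= Lam * `|p - q|).

Let Step y z := [/\ z 0 = x0, continuous z & forall t, 0 < t ->
  is_derive (t : R^o) (1 : R^o) (z : R^o -> 'cV[R]_n) (f (y t))].

Lemma lipschitz_comp_continuous y : continuous y -> continuous (f \o y).
Proof.
move=> yc t; apply/cvgrPdist_lt => e e0; near=> s.
apply: le_lt_trans (fL _ _) _; rewrite mulrC -ltr_pdivlMr //.
near: s; have /cvgrPdist_lt := yc t; apply; exact: divr_gt0.
Unshelve. all: by end_near. Qed.

Lemma picard_step y : continuous y -> exists z, Step y z.
Proof.
move=> yc.
have fyc := lipschitz_comp_continuous yc.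
have /choice[G hG] : forall i, exists G : R -> R, G 0 = 0 /\ forall t, -1 < t ->
    is_derive (t : R^o) (1 : R^o) (G : R^o -> R^o) (f (y t) i 0).
  by move=> i; apply: (@continuous_antiderivative (fun t => f (y t) i 0)) => t;
     exact: continuous_coord fyc t.
have maxc (t : R) : {for t, continuous (fun s : R => Num.max s 0)}.
  by apply: (@continuous_max R R id (cst 0)); [exact: cvg_id|exact: cvg_cst].
(* Freezing time at 0 makes the iterate continuous on the whole line, as the next iteration
   requires, and changes nothing at positive times. *)
exists (fun t => \col_i (x0 i 0 + G i (Num.max t 0))); split.
- by apply/matrixP => i j; rewrite mxE maxxx (hG i).1 addr0 (ord1 j).
- apply: coord_continuous_vec => i.
  under eq_fun do rewrite mxE.
  move=> t; apply: cvgD; first exact: cvg_cst.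
  apply: (@continuous_comp _ _ _ (fun s : R => Num.max s 0) (G i)).
    exact: maxc.
  apply: differentiable_continuous; apply/derivable1_diffP.
  have m1 : -1 < Num.max t 0 by rewrite lt_max ltrN10 orbT.
  by case: ((hG i).2 _ m1).
- move=> t t0; apply: is_derive_vec => i.
  have t1 : -1 < t by apply: lt_trans t0; rewrite ltrN10.
  have := is_deriveD (is_derive_cst (x0 i 0 : R^o) (t : R^o) (1 : R^o)) ((hG i).2 t t1).
  rewrite add0r => h; apply: near_eq_is_derive h.
  by near=> s; rewrite mxE /= max_l // ltW //; near: s; exact: lt_nbhsr.
Unshelve. all: by end_near. Qed.

Lemma continuous_expR_scale (c A : R) : continuous (fun s => A * expR (c * s)).
Proof.
move=> t; apply: (@differentiable_continuous _ _ _ t (fun s => A * expR (c * s))).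
apply/derivable1_diffP.
by case: (is_derive_expR_scale c A t).
Qed.

Local Notation weight t := (expR (2 * Lam * t)).

(* In the norm [sup_t |y t| / expR (2 Lam t)] the Picard operator has Lipschitz
   constant 1/2 on the whole half-line. *)
Lemma picard_step_contract y y' z z' A : 0 <= A -> Step y z -> Step y' z' ->
  (forall t, 0 <= t -> `|y t - y' t| <= A * weight t) ->
  forall t, 0 <= t -> `|z t - z' t| <= A / 2 * weight t.
Proof.
move=> A0 [z0 zc dz] [z0' zc' dz'] hy t t0.
have A20 : 0 <= A / 2 by rewrite divr_ge0.
(* The comparison function has derivative [Lam * (A * weight s)], exactly the Lipschitz bound for
   the integrand; the 2 in the exponent of the weight produces the factor 1/2. *)
have := @vec_increment_le (fun s => z s - z' s) (fun s => A / 2 * weight s)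
  (fun s => f (y s) - f (y' s)) (fun s => A / 2 * (2 * Lam * weight s)) 0 t t0.
rewrite /= z0 z0' subrr subr0 => h; apply: le_trans (h _ _ _ _ _ _) _.
- by move=> s; apply: cvgB; [exact: zc|exact: zc'].
- exact: continuous_expR_scale.
- by move=> s s0 _; apply: is_deriveB; [exact: dz|exact: dz'].
- by move=> s _ _; exact: is_derive_expR_scale.
- move=> s s0 _; apply: le_trans (fL _ _) _.
  have -> : A / 2 * (2 * Lam * weight s) = Lam * (A * weight s) by field.
  by rewrite ler_pM2l // hy // ltW.
- by rewrite ler_wpM2l // ler_expR ler_wpM2l // mulr_ge0 // ltW.
- by rewrite gerBl mulr_ge0 ?expR_ge0.
Qed.

Lemma geometric_small (B e : R) : 0 < e ->
  exists N, forall k, (N <= k)%N -> B * 2^-1 ^+ k < e.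
Proof.
move=> e0; exists (Num.bound (`|B| / e)) => k Nk.
have := archi_boundP (divr_ge0 (normr_ge0 B) (ltW e0)).
rewrite exprVn ltr_pdivrMr // ltr_pdivrMr ?exprn_gt0 // => h.
apply: le_lt_trans (ler_norm _) _; apply: lt_le_trans h _.
rewrite mulrC ler_pM2l // -natrX ler_nat; apply: leq_trans Nk _.
exact/ltnW/ltn_expl.
Qed.

Lemma picard_global : exists x, [/\ x 0 = x0,
  forall t, 0 < t -> is_derive (t : R^o) (1 : R^o) (x : R^o -> 'cV[R]_n) (f (x t))
  & forall b, 0 <= b -> exists2 C, 0 < C & forall s t, 0 <= s -> s <= t -> t <= b ->
      `|x t - x s| <= C * (t - s)].
Proof.
(* A discontinuous curve is sent to itself, an arbitrary value; all iterates below are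
   continuous. *)
have /choice[Gam hGam] : forall y, exists z, continuous y -> Step y z.
  move=> y; have [yc|nyc] := pselect (continuous y); last by exists y.
  by have [z hz] := picard_step yc; exists z.
pose u k := iter k Gam (cst x0).
have uc k : continuous (u k).
  elim: k => [|k ih]; first by move=> t; exact: cvg_cst.
  by have [] := hGam _ ih.
have uS k : Step (u k) (u k.+1) by exact: hGam.
(* With this [A] the derivative of [A * weight] is at least the norm of [f x0], so it dominates the
   first increment. *)
pose A := `|f x0| / (2 * Lam).
have L20 : 0 < 2 * Lam by rewrite mulr_gt0.
have A0 : 0 <= A by rewrite divr_ge0 // ltW.
have w_ge0 t : 0 <= weight t by exact: expR_ge0.
pose q k : R := A * 2^-1 ^+ k.
have q0 k : 0 <= q k by rewrite mulr_ge0 // exprn_ge0.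
have qS k : q k.+1 = q k / 2 by rewrite /q exprSr mulrA.
have D k t : 0 <= t -> `|u k.+1 t - u k t| <= q k * weight t.
  elim: k t => [|k ih] t t0; last first.
    by rewrite qS; exact: (picard_step_contract (q0 k) (uS k.+1) (uS k) ih).
  have [z0 zc dz] := uS 0%N.
  have := @vec_increment_le (u 1%N) (fun s => A * weight s)
    (fun s => f x0) (fun s => A * (2 * Lam * weight s)) 0 t t0 zc.
  rewrite z0 => h; rewrite /q mulr1; apply: le_trans (h _ _ _ _ _) _.
  - exact: continuous_expR_scale.
  - by move=> s s0 _; exact: dz.
  - by move=> s _ _; exact: is_derive_expR_scale.
  - move=> s s0 _; have -> : A * (2 * Lam * weight s) = `|f x0| * weight s.
      by rewrite /A; field; rewrite gt_eqF.
    by apply: ler_peMr => //; rewrite -[leLHS]expR0 ler_expR mulr_ge0 // ltW.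
  - by rewrite ler_wpM2l // ler_expR ler_wpM2l // ltW.
  - by rewrite gerBl mulr_ge0.
(* Since [q] halves at each index, [q k = 2 * q k - 2 * q k.+1], and the increments telescope. *)
have tele k m t : 0 <= t ->
    `|u (k + m)%N t - u k t| <= (2 * q k - 2 * q (k + m)%N) * weight t.
  move=> t0; elim: m => [|m ih]; first by rewrite addn0 !subrr normr0 mul0r.
  rewrite addnS qS -(subrKA (u (k + m)%N t)); apply: le_trans (ler_normD _ _) _.
  have := D (k + m)%N t t0; lra.
have tele_le k l t : 0 <= t -> (k <= l)%N -> `|u l t - u k t| <= 2 * q k * weight t.
  move=> t0 /subnKC <-; apply: le_trans (tele _ _ _ t0) _.
  by apply: ler_wpM2r => //; rewrite gerBl mulr_ge0.
have /choice[Y0 hY0] : forall t, exists l, 0 <= t ->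
    forall k, `|u k t - l| <= 2 * q k * weight t.
  move=> t; have [t0|tneg] := leP 0 t; last by exists 0.
  have [e e0|l hl] := @cauchy_limit R n (fun k => u k t).
    have [N hN] := @geometric_small (n%:R * (4 * A * weight t)) e e0.
    exists N => k l Nk Nl; apply: le_lt_trans (hN N (leqnn N)).
    apply: le_trans (enorm_le_normr _) _.
    rewrite -(mulrA n%:R) ler_wpM2l //.
    have := tele_le N k t t0 Nk; have := tele_le N l t t0 Nl.
    have := ler_normB (u k t - u N t) (u l t - u N t).
    have -> : u k t - u N t - (u l t - u N t) = u k t - u l t by rewrite opprB subrKA.
    by rewrite /q; move: (2^-1 ^+ N) => p; lra.
  exists l => _ k; apply/ler_addgt0Pr => e /hl[N hN].
  pose m := maxn k N.
  have := hN m (leq_maxr _ _); have := tele_le k m t t0 (leq_maxl _ _).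
  have := normr_le_enorm (u m t - l); have := ler_distD (u m t) (u k t) l.
  rewrite (distrC (u k t) (u m t)); lra.
pose Y t := Y0 (Num.max t 0).
have max0 (t : R) : 0 <= Num.max t 0 by rewrite le_max lexx orbT.
have YY0 t : 0 <= t -> Y t = Y0 t by move=> t0; rewrite /Y max_l.
have maxc (t : R) : {for t, continuous (fun s : R => Num.max s 0)}.
  by apply: (@continuous_max R R id (cst 0)); [exact: cvg_id|exact: cvg_cst].
(* Convergence is uniform on bounded times, here up to the modulus of [t] plus 1; the rest is an
   [e / 3] argument. *)
have Yc : continuous Y.
  move=> t; apply/cvgrPdist_lt => e e0.
  pose W := weight (`|t| + 1).
  have e30 : 0 < e / 3 by rewrite divr_gt0.
  have [k /(_ k (leqnn k)) hk] := @geometric_small (2 * A * W) (e / 3) e30.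
  have close s : Num.max s 0 <= `|t| + 1 -> `|u k (Num.max s 0) - Y s| < e / 3.
    move=> st; apply: le_lt_trans (hY0 _ (max0 s) k) _; apply: le_lt_trans hk.
    have hw : weight (Num.max s 0) <= W by rewrite ler_expR ler_wpM2l // ltW.
    apply: le_trans (ler_wpM2l _ hw) _; first by rewrite mulr_ge0.
    by rewrite /q mulrA mulrAC.
  have ct : Num.max t 0 <= `|t| + 1.
    by rewrite ge_max addr_ge0 // andbT (le_trans (ler_norm t)) // lerDl.
  near=> s.
  have cs : Num.max s 0 <= `|t| + 1.
    rewrite ge_max addr_ge0 // andbT.
    apply: (@le_trans _ _ (t + 1)); last by rewrite lerD2r ler_norm.
    by apply/ltW; near: s; apply: lt_nbhsl; rewrite ltrDl.
  have mid : `|u k (Num.max t 0) - u k (Num.max s 0)| < e / 3.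
    near: s; have : {for t, continuous (u k \o (fun s : R => Num.max s 0))}.
      by apply: continuous_comp; [exact: maxc|exact: uc].
    by move=> /cvgrPdist_lt; apply.
  have h1 := close t ct; have h2 := close s cs.
  have := ler_distD (u k (Num.max t 0)) (Y t) (Y s).
  have := ler_distD (u k (Num.max s 0)) (u k (Num.max t 0)) (Y s).
  by rewrite (distrC (Y t) (u k _)); lra.
(* The limit [Y] is not differentiated directly: one more Picard step gives a differentiable [z],
   and by contraction both are limits of the iterates on the half-line. *)
have [z hz] := picard_step Yc.
have zY t : 0 <= t -> z t = Y t.
  move=> t0; apply/eqP; rewrite -subr_eq0 -normr_eq0 eq_le normr_ge0 andbT.
  apply/ler_addgt0Pr => e e0; rewrite add0r.
  have [k /(_ k (leqnn k)) hk] := @geometric_small (2 * A * weight t) e e0.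
  have hYu s : 0 <= s -> `|u k s - Y s| <= 2 * q k * weight s.
    by move=> s0; rewrite YY0 //; exact: hY0.
  have q20 : 0 <= 2 * q k by rewrite mulr_ge0.
  have h1 := picard_step_contract q20 (uS k) hz hYu t0.
  have h2 := hY0 t t0 k.+1; rewrite -(YY0 t t0) qS in h2.
  have := ler_distD (u k.+1 t) (z t) (Y t); rewrite (distrC (z t) (u _ _)).
  rewrite /q in h1 h2.
  move: (2^-1 ^+ k) h1 h2 hk => p; lra.
have [z0 zc dz] := hz.
exists z; split=> // [t t0|b b0]; first by rewrite zY ?ltW //; exact: dz.
(* This bounds [f] along [Y] up to time [b]: the iterate of index 0 is the constant [x0], so [hY0]
   at 0 bounds the distance from [Y] to [x0]. *)
pose C := `|f x0| + Lam * (2 * q 0%N * weight b) + 1.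
have C0 : 0 < C.
  by rewrite ltr_wpDl // addr_ge0 // mulr_ge0 ?(ltW Lam0) // mulr_ge0 // mulr_ge0.
exists C => // s t s0 st tb.
have := @vec_increment_le z (fun s => C * s) (f \o Y) (fun _ => C) s t st zc.
rewrite mulrBr; apply.
- by move=> r; apply: cvgM; [exact: cvg_cst|exact: cvg_id].
- by move=> r sr _; apply: dz; exact: le_lt_trans sr.
- move=> r _ _; have := is_deriveZ C (is_derive_id (r : R^o) (1 : R^o)).
  by rewrite /GRing.scale /= mulr1.
- move=> r sr rt /=; have r0 : 0 <= r by rewrite (le_trans s0) // ltW.
  rewrite -[f (Y r)](subrK (f x0)); apply: le_trans (ler_normD _ _) _.
  have h1 := fL (Y r) x0.
  have h2 : `|Y r - x0| <= 2 * q 0%N * weight b.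
    rewrite distrC YY0 //; apply: le_trans (hY0 r r0 0%N) _.
    apply: ler_wpM2l; first by rewrite mulr_ge0.
    by rewrite ler_expR ler_wpM2l ?(ltW L20) // (le_trans (ltW rt)).
  have := ler_wpM2l (ltW Lam0) h2; rewrite /C; lra.
- by rewrite ler_wpM2l // ltW.
Unshelve. all: by end_near. Qed.

End Iteration.

End Picard.

(** * The flow of the variable-metric projection *)

Lemma ler_of_sqr_le_mul (R : realDomainType) (a b : R) :
  0 <= b -> a ^+ 2 <= a * b -> a <= b.
Proof.
move=> b0; have [a0|a0 _] := ltP 0 a; last exact: le_trans b0.
by rewrite expr2 ler_pM2l.
Qed.

(** When [S] is a single point nothing ties [mu] to [K], and the radicand of [rho] may be negative;
    [Num.sqrt] is then 0 and this one-sided form still holds. *)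
Lemma ge_sqr_sqrtr (R : rcfType) (a : R) : a <= Num.sqrt a ^+ 2.
Proof.
have [a0|/ltW a0] := leP 0 a; first by rewrite sqr_sqrtr.
exact: le_trans a0 (sqr_ge0 _).
Qed.

Section Metric.
Context {R : realType} {n : nat} (S : set 'cV[R]_n)
  (F : 'cV[R]_n -> 'cV[R]_n) (M : 'cV[R]_n -> 'M[R]_n)
  (L K KM mu lambda alpha : R) (xbar : 'cV[R]_n).
Hypotheses (S_neq0 : S !=set0) (S_closed : closed S) (S_convex : convex_set S)
  (M_spd : forall x, spd (M x))
  (L_ge1 : 1 <= L) (K_gt0 : 0 < K) (KM_gt0 : 0 < KM) (mu_gt0 : 0 < mu)
  (M_bound : forall x, S x -> opnorm (M x) <= L)
  (Minv_bound : forall x, S x -> opnorm (invmx (M x)) <= L)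
  (F_lip : forall x y, S x -> S y -> enorm (F x - F y) <= K * enorm (x - y))
  (M_lip : forall x y, S x -> S y ->
    opnorm (M x - M y) <= KM * enorm (x - y))
  (F_mono : forall x y, S x -> S y ->
    mu * enorm (x - y) ^+ 2 <= dot (F x - F y) (x - y))
  (lambda_gt0 : 0 < lambda)
  (alpha_gt0 : 0 < alpha) (alpha_lt : alpha < 2 * mu / (L * K ^+ 2))
  (xbar_sol : SOL F S xbar).

Let L_gt0 : 0 < L. Proof. exact: lt_le_trans L_ge1. Qed.

Local Notation rho := (Num.sqrt (1 - 2 * alpha * mu / L + alpha ^+ 2 * K ^+ 2)).
Local Notation Q x := (invmx (M x)).
Local Notation T := (Tmap S F M alpha).
Local Notation v := (fun x => lambda *: (T x - x)).
Local Notation r := (fun x => wnorm (Q x) (x - xbar)).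
Local Notation CL := (2^-1 * (L * Num.sqrt L) * KM * (1 + rho)).

Let Q_spd x : spd (Q x). Proof. exact: spd_inv. Qed.

Let S_xbar : S xbar. Proof. by have [] := xbar_sol. Qed.

Lemma step_gap_gt0 : 0 < 2 * mu - alpha * (L * K ^+ 2).
Proof. by rewrite subr_gt0 -ltr_pdivlMr // mulr_gt0 // exprn_gt0. Qed.

Lemma rho_lt1 : rho < 1.
Proof.
rewrite -[X in _ < X]sqrtr1 ltr_sqrt ?ltr01 //.
have -> : 1 - 2 * alpha * mu / L + alpha ^+ 2 * K ^+ 2 =
    1 - alpha * ((2 * mu - alpha * (L * K ^+ 2)) / L) by field; rewrite gt_eqF.
by rewrite gtrBl mulr_gt0 // divr_gt0 // step_gap_gt0.
Qed.

Lemma CL_gt0 : 0 < CL.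
Proof. by rewrite !mulr_gt0 ?sqrtr_gt0 // ltr_wpDr. Qed.

Lemma Tmap_mem x : S (T x).
Proof. exact: proj_mem. Qed.

(** [Q x] cancels the [M x] in front of [F x], so [F] appears in the Euclidean inner product and can
    be combined with the condition defining [SOL], which knows no metric. *)
Lemma Tmap_variational x w : S w ->
  0 <= dot (w - T x) (Q x *m (T x - x) + alpha *: F x).
Proof.
move=> Sw; have := proj_variational (x - alpha *: (M x *m F x)) S_neq0 S_closed
  S_convex (Q_spd x) Sw.
rewrite -/(Tmap S F M alpha x) opprB addrCA addrC mulmxDr -scalemxAr.
by rewrite mulKmx ?spd_unitmx // addrC.
Qed.

Lemma sqr_residual x : S x -> r x ^+ 2 = dot (x - xbar) (Q x *m (x - xbar)).
Proof. by move=> Sx; rewrite sqr_wnorm. Qed.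

(** As a solution, [xbar] is fixed by the projected step in every frozen metric. Hence [T x - xbar]
    is dominated, in the norm of [Q x], by the difference [d - alpha *: (M x *m D)] of the two
    unprojected steps. *)
Lemma Tmap_contract x : S x -> wnorm (Q x) (T x - xbar) <= rho * r x.
Proof.
move=> Sx; have ST := Tmap_mem x.
pose d := x - xbar; pose e := T x - xbar; pose D := F x - F xbar.
have h1 : dot e (Q x *m e) <= dot e (Q x *m (d - alpha *: (M x *m D))).
  have v1 := Tmap_variational x S_xbar; have v2 := proj2 xbar_sol _ ST.
  rewrite -subr_ge0; move: v1 (mulr_ge0 (ltW alpha_gt0) v2).
  rewrite -[xbar - T x]opprB -/e.
  have -> : T x - x = e - d by rewrite /e /d opprB addrA subrK.
  have -> : F x = D + F xbar by rewrite subrK.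
  clearbody d e D; rewrite !(mulmxBr, =^~ scalemxAr) mulKmx ?spd_unitmx //.
  rewrite scalerDr !dot_lin (dotC (F xbar) e); lra.
have h2 : wnorm (Q x) e <= wnorm (Q x) (d - alpha *: (M x *m D)).
  apply: ler_of_sqr_le_mul (wnorm_ge0 _ _) _; rewrite sqr_wnorm //.
  exact: le_trans h1 (dot_le_wnorm _ _ (Q_spd x)).
apply: le_trans h2 _.
rewrite -ler_sqr ?nnegrE ?mulr_ge0 ?wnorm_ge0 ?sqrtr_ge0 //.
apply: (@le_trans _ _
  ((1 - 2 * alpha * mu / L + alpha ^+ 2 * K ^+ 2) * r x ^+ 2)); last first.
  by rewrite exprMn ler_wpM2r ?sqr_ge0 ?ge_sqr_sqrtr.
rewrite !sqr_wnorm // -/d.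
have hd : dot d (Q x *m d) / L <= dot d d.
  by rewrite ler_pdivrMr // mulrC dot_opnorm_le ?Minv_bound.
have hm : mu * dot d d <= dot d D by rewrite -sqr_enorm dotC F_mono.
have hM : dot D (M x *m D) <= L * (K ^+ 2 * dot d d).
  apply: le_trans (dot_opnorm_le _ (M_bound Sx)) _; rewrite ler_pM2l //.
  rewrite -!sqr_enorm -exprMn ler_sqr ?nnegrE ?mulr_ge0 ?enorm_ge0 ?(ltW K_gt0) //.
  exact: F_lip.
clear h1; clearbody d D.
rewrite !(mulmxBr, =^~ scalemxAr) mulKmx ?spd_unitmx // !dot_lin.
rewrite (dotC (M x *m D) (Q x *m d)) (dot_mull (Q x) d) (proj1 (Q_spd x)) mulKmx ?spd_unitmx //.
rewrite (dotC _ D).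
have a1 := ler_wpM2l (ltW alpha_gt0) hm.
have a2 := ler_wpM2l (ltW (exprn_gt0 2 alpha_gt0)) hM.
(* Both terms in [dot d d] are merged first: their joint coefficient
   [- alpha * (2 * mu - alpha * (L * K ^ 2))] is negative, so the lower bound [hd] applies to the
   whole. Bounding the quadratic term alone would turn [alpha ^ 2 * K ^ 2] into
   [L ^ 2 * alpha ^ 2 * K ^ 2]. *)
have a3 := ler_wpM2l (ltW (mulr_gt0 alpha_gt0 step_gap_gt0)) hd.
move: a1 a2 a3; set q := dot d (Q x *m d); rewrite (dotC D d).
have -> : (1 - 2 * alpha * mu / L + alpha ^+ 2 * K ^+ 2) * q =
  q - alpha * (2 * mu - alpha * (L * K ^+ 2)) * (q / L) by field; rewrite gt_eqF.
by rewrite (dotC (M x *m D) D); nra.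
Qed.

Lemma residual_le_enorm x : S x -> r x <= Num.sqrt L * enorm (x - xbar).
Proof. by move=> Sx; apply: wnorm_le_enorm; exact: Minv_bound. Qed.

Lemma enorm_le_residual x u : S x -> enorm u <= Num.sqrt L * wnorm (Q x) u.
Proof. by move=> Sx; apply: enorm_le_wnorm; rewrite ?M_bound // ltW. Qed.

Lemma Tmap_displacement_wnorm x : S x ->
  wnorm (Q x) (T x - x) <= (1 + rho) * r x.
Proof.
move=> Sx; have -> : T x - x = (T x - xbar) + (xbar - x) by rewrite addrA subrK.
apply: le_trans (ler_wnormD _ _ (Q_spd x)) _.
have -> : wnorm (Q x) (xbar - x) = r x.
  by rewrite /wnorm -[xbar - x]opprB mulmxN dotNl dotNr opprK.
by rewrite mulrDl mul1r addrC lerD2l Tmap_contract.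
Qed.

Lemma Tmap_displacement x : S x ->
  enorm (T x - x) <= 2 * L * enorm (x - xbar).
Proof.
move=> Sx; apply: le_trans (enorm_le_residual _ Sx) _.
have -> : 2 * L * enorm (x - xbar) =
    Num.sqrt L * (2 * (Num.sqrt L * enorm (x - xbar))).
  by rewrite -{1}(sqr_sqrtr (ltW L_gt0)); ring.
rewrite ler_wpM2l ?sqrtr_ge0 //; apply: le_trans (Tmap_displacement_wnorm Sx) _.
apply: ler_pM; rewrite ?addr_ge0 ?sqrtr_ge0 ?wnorm_ge0 //.
  by have := rho_lt1; lra.
exact: residual_le_enorm.
Qed.

Lemma metric_lipschitz x y u : S x -> S y ->
  enorm ((Q x - Q y) *m u) <= L ^+ 2 * KM * enorm (x - y) * enorm u.
Proof.
move=> Sx Sy; rewrite invmxB ?spd_unitmx // -!mulmxA.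
apply: le_trans (opnorm_leP _ (Minv_bound Sx)) _.
have -> : L ^+ 2 * KM * enorm (x - y) * enorm u =
  L * (KM * enorm (x - y) * (L * enorm u)) by ring.
rewrite ler_pM2l //; rewrite enormC.
apply: le_trans (opnorm_leP _ (M_lip Sy Sx)) _.
rewrite ler_wpM2l ?mulr_ge0 ?enorm_ge0 ?(ltW KM_gt0) //.
exact: opnorm_leP (Minv_bound Sy).
Qed.

(** The variational inequalities at [x] and at [y] are each tested with the image of the other
    point. The change of metric acts on [T y - y], so the constant is uniform only where that step
    is bounded. *)
Lemma Tmap_lipschitz x y : S x -> S y ->
  enorm (T x - T y) <=
    L * (L + L ^+ 2 * KM * enorm (T y - y) + alpha * K) * enorm (x - y).
Proof.
move=> Sx Sy.
move: (Tmap_variational x (Tmap_mem y)) (Tmap_variational y (Tmap_mem x)).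
move: (T x) (T y) => Tx Ty v1 v2; pose e := Tx - Ty.
pose g := Q x *m (y - x) + (Q x - Q y) *m (Ty - y) + alpha *: (F x - F y).
have h1 : dot e (Q x *m e) <= dot (- e) g.
  move: v1 v2; have -> : Tx - x = e + (Ty - y) + (y - x).
    by rewrite /e !subrKA.
  have -> : Ty - Tx = - e by rewrite opprB.
  rewrite -/e /g; clearbody e.
  rewrite mulmxBl !mulmxDr scalerBr !dot_lin; lra.
have h2 : enorm e ^+ 2 <= enorm e * (L * enorm g).
  rewrite sqr_enorm; apply: le_trans (dot_le_inv _ (M_spd x) (M_bound Sx)) _.
  rewrite mulrCA ler_pM2l //; apply: le_trans h1 _.
  by apply: le_trans (dot_le _ _) _; rewrite enormN.
apply: le_trans (ler_of_sqr_le_mul _ h2) _.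
  by rewrite mulr_ge0 ?enorm_ge0 // ltW.
rewrite -mulrA ler_pM2l //; rewrite !mulrDl.
apply: le_trans (ler_enormD _ _) _; apply: lerD; last first.
  by rewrite enormZ gtr0_norm // -mulrA ler_pM2l // F_lip.
apply: le_trans (ler_enormD _ _) _; apply: lerD.
  by rewrite (enormC x); exact: opnorm_leP (Minv_bound Sx).
by rewrite mulrAC; exact: metric_lipschitz.
Qed.

(** The first-order terms are kept sharp because they fix the rate; the coefficient of the squared
    step may be crude, since that term disappears for small steps. *)
Lemma residual_step x y B : S x -> S y -> enorm (x - xbar) <= B ->
  r y ^+ 2 - r x ^+ 2 <=
    2 * dot (Q x *m (x - xbar)) (y - x)
    + KM * enorm (Q x *m (x - xbar)) ^+ 2 * enorm (y - x)
    + (L ^+ 3 * KM ^+ 2 * B ^+ 2 + 2 * (L ^+ 2 * KM * B) + L) * enorm (y - x) ^+ 2.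
Proof.
move=> Sx Sy; pose d := x - xbar; rewrite -/d => dB; pose w := y - x.
rewrite -/w !sqr_wnorm // -/d.
have -> : y - xbar = d + w by rewrite /d /w [RHS]addrC subrKA.
pose E := (Q y - Q x) *m d.
have B0 : 0 <= B := le_trans (enorm_ge0 _) dB.
have hE : enorm E <= L ^+ 2 * KM * enorm w * B.
  apply: le_trans (metric_lipschitz _ Sy Sx) _.
  by rewrite ler_wpM2l // !mulr_ge0 ?enorm_ge0 ?sqr_ge0 // ltW.
have -> : dot (d + w) (Q y *m (d + w)) - dot d (Q x *m d) =
    2 * dot (Q x *m d) w + dot d E + 2 * dot w E + dot w (Q y *m w).
  rewrite /E; clearbody d w.
  rewrite mulmxBl mulmxDr !dot_lin (dot_sym d w (proj1 (Q_spd y))).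
  by rewrite (dotC (Q x *m d) w); ring.
have hwE : dot w E <= L ^+ 2 * KM * B * enorm w ^+ 2.
  apply: le_trans (dot_le _ _) _.
  have := ler_wpM2l (enorm_ge0 w) hE; rewrite expr2; lra.
have hww : dot w (Q y *m w) <= L * enorm w ^+ 2.
  by rewrite sqr_enorm; exact: dot_opnorm_le (Minv_bound Sy).
have hdE : dot d E <= KM * enorm (Q x *m d) ^+ 2 * enorm w
    + L ^+ 3 * KM ^+ 2 * B ^+ 2 * enorm w ^+ 2.
  rewrite /E invmxB ?spd_unitmx // -!mulmxA -{1}(proj1 (Q_spd y)) -dot_mull.
  (* Replacing [Q y *m d] by [p] costs [E], which is of first order in [w] and is paired with
     another first-order factor, hence goes into the remainder. *)
  set p := Q x *m d; have -> : Q y *m d = p + E by rewrite /E mulmxBl addrC subrK.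
  have hMp : enorm ((M x - M y) *m p) <= KM * enorm w * enorm p.
    by apply: opnorm_leP; rewrite /w (enormC y); exact: M_lip.
  have hp : enorm p <= L * B.
    apply: le_trans (opnorm_leP _ (Minv_bound Sx)) _; by rewrite ler_pM2l.
  rewrite dotDl; apply: lerD.
    apply: le_trans (dot_le _ _) _.
    have := ler_wpM2l (enorm_ge0 p) hMp; rewrite expr2; lra.
  apply: le_trans (dot_le _ _) _.
  have -> : L ^+ 3 * KM ^+ 2 * B ^+ 2 * enorm w ^+ 2 =
    (L ^+ 2 * KM * enorm w * B) * (KM * enorm w * (L * B)) by ring.
  apply: ler_pM => //; rewrite ?enorm_ge0 //; apply: le_trans hMp _.
  by rewrite ler_wpM2l // mulr_ge0 ?enorm_ge0 // ltW.
by move: hwE hww hdE; rewrite !mulrDl; lra.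
Qed.

(** The contraction contributes [rho - 1] to the radial term. In the metric term, [L * r x ^ 2]
    bounds the squared norm and [Num.sqrt L * (1 + rho) * r x] the step; their product with
    [KM * lambda] is [2 * lambda * CL * r x ^ 3]. *)
Lemma residual_drift x : S x ->
  2 * dot (Q x *m (x - xbar)) (v x)
    + KM * enorm (Q x *m (x - xbar)) ^+ 2 * enorm (v x)
  <= - (2 * lambda * (1 - rho - CL * r x)) * r x ^+ 2.
Proof.
move=> Sx; pose d := x - xbar; rewrite -/d.
have r0 : 0 <= r x by exact: wnorm_ge0.
have h1 : dot (Q x *m d) (T x - x) <= (rho - 1) * r x ^+ 2.
  have -> : T x - x = (T x - xbar) - d by rewrite opprB addrA subrK.
  rewrite dotBr mulrBl mul1r (dotC _ d) -/d -(sqr_residual Sx) lerD2r dotC.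
  apply: le_trans (dot_le_wnorm _ _ (Q_spd x)) _.
  by rewrite expr2 mulrA ler_wpM2r // Tmap_contract.
have h2 : enorm (Q x *m d) ^+ 2 <= L * r x ^+ 2.
  by rewrite sqr_residual //; exact: enorm_inv_le (Minv_bound Sx).
have h3 : enorm (T x - x) <= Num.sqrt L * ((1 + rho) * r x).
  apply: le_trans (enorm_le_residual _ Sx) _.
  by rewrite ler_wpM2l ?sqrtr_ge0 // Tmap_displacement_wnorm.
have h4 : enorm (Q x *m d) ^+ 2 * enorm (T x - x) <=
    L * r x ^+ 2 * (Num.sqrt L * ((1 + rho) * r x)).
  by apply: ler_pM => //; rewrite ?sqr_ge0 ?enorm_ge0.
rewrite dotZr enormZ gtr0_norm //.
have := ler_wpM2l (ltW lambda_gt0) h1.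
have := ler_wpM2l (ltW (mulr_gt0 KM_gt0 lambda_gt0)) h4.
move: (dot _ _) (enorm (Q x *m d) ^+ 2) (enorm (T x - x)) => a b c.
by move: (r x) (Num.sqrt L) rho => s l p; lra.
Qed.

Lemma residual_lipschitz_on B : 0 <= B -> exists2 C, 0 < C & forall x y,
  S x -> S y -> enorm (x - xbar) <= B -> enorm (y - xbar) <= B ->
  `|r y ^+ 2 - r x ^+ 2| <= C * enorm (y - x).
Proof.
move=> B0.
pose C0 := L ^+ 3 * KM ^+ 2 * B ^+ 2 + 2 * (L ^+ 2 * KM * B) + L.
have LB0 : 0 <= L * B by rewrite mulr_ge0 // ltW.
have C00 : 0 < C0.
  by rewrite ltr_wpDl // addr_ge0 // !mulr_ge0 ?exprn_ge0 // ltW.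
pose C := 2 * (L * B) + KM * (L * B) ^+ 2 + C0 * (2 * B) + 1.
have Cgt0 : 0 < C.
  rewrite ltr_wpDl // !addr_ge0 // !mulr_ge0 ?sqr_ge0 //; exact: ltW.
exists C => //.
suff half x y : S x -> S y -> enorm (x - xbar) <= B -> enorm (y - xbar) <= B ->
    r y ^+ 2 - r x ^+ 2 <= C * enorm (y - x).
  move=> x y Sx Sy xB yB; rewrite ler_norml half // andbT.
  by rewrite lerNl opprB (enormC y); exact: half.
move=> Sx Sy xB yB.
apply: le_trans (residual_step Sx Sy xB) _; rewrite -/C0.
have hw : enorm (y - x) <= 2 * B.
  by apply: le_trans (ler_enorm_distD xbar _ _) _; rewrite (enormC xbar); lra.
have hQ : enorm (Q x *m (x - xbar)) <= L * B.
  by apply: le_trans (opnorm_leP _ (Minv_bound Sx)) _; rewrite ler_pM2l.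
have h1 := dot_le (Q x *m (x - xbar)) (y - x).
have w0 := enorm_ge0 (y - x).
have h2 := ler_wpM2r w0 hQ.
have h3 : enorm (Q x *m (x - xbar)) ^+ 2 <= (L * B) ^+ 2.
  by rewrite ler_sqr ?nnegrE ?enorm_ge0.
have h4 := ler_wpM2l (ltW KM_gt0) (ler_wpM2r w0 h3).
have h5 := ler_wpM2l (ltW C00) (ler_wpM2r w0 hw).
rewrite /C; clearbody C0; move: h1 h2 h4 h5 w0.
move: (enorm (y - x)) (dot _ _) (enorm (Q x *m _) ^+ 2) (L * B) => w a q l; lra.
Qed.

Lemma residual_dini (x : R -> 'cV[R]_n) (t : R) (vx : 'cV[R]_n) :
  S (x t) -> vx = v (x t) ->
  is_derive (t : R^o) (1 : R^o) (x : R^o -> 'cV[R]_n) vx ->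
  forall eps, 0 < eps -> exists2 h0, 0 < h0 & forall h, 0 < h -> h < h0 ->
    S (x (t + h)) -> r (x (t + h)) ^+ 2 <= r (x t) ^+ 2 +
      h * (- (2 * lambda * (1 - rho - CL * r (x t))) * r (x t) ^+ 2 + eps).
Proof.
move=> Sx vxE dx eps eps0.
have := residual_drift Sx; rewrite /= -vxE => drift.
pose B := enorm (x t - xbar).
pose C := L ^+ 3 * KM ^+ 2 * B ^+ 2 + 2 * (L ^+ 2 * KM * B) + L.
have B0 : 0 <= B by exact: enorm_ge0.
have C0 : 0 < C.
  by rewrite ltr_wpDl // addr_ge0 // !mulr_ge0 ?exprn_ge0 // ltW.
pose a := enorm (Q (x t) *m (x t - xbar)).
have a0 : 0 <= a by exact: enorm_ge0.
(* [D] collects the coefficients of the differentiation error, and [E] below governs the quadratic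
   remainder; each is allotted half of [eps]. *)
pose D := 2 * a + KM * a ^+ 2 + 1.
have D0 : 0 < D by rewrite ltr_wpDl // addr_ge0 // mulr_ge0 ?sqr_ge0 // ltW.
pose eta := Num.min 1 (eps / 2 / D).
have eta0 : 0 < eta by rewrite lt_min ltr01 !divr_gt0.
have eta1 : eta <= 1 by rewrite ge_min lexx.
have etaD : eta * D <= eps / 2.
  by rewrite -ler_pdivlMr // ge_min lexx orbT.
pose E := C * (enorm (vx) + 1) ^+ 2.
have E0 : 0 < E by rewrite mulr_gt0 // exprn_gt0 // ltr_wpDl ?enorm_ge0.
have [h1 h10 hx] := is_derive_enorm dx eta0.
exists (Num.min h1 (eps / 2 / E)) => [|h hpos].
  by rewrite lt_min h10 !divr_gt0.
rewrite lt_min => /andP[hh1 hE] Sxh.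
have {hx} := hx h hpos hh1.
have hEle : h * E <= eps / 2 by rewrite -ler_pdivlMr // ltW.
rewrite -lerBlDl; move: (residual_step Sx Sxh (lexx B)); rewrite -/C.
set w := x (t + h) - x t; set e := w - h *: vx => + he.
have wE : w = h *: vx + e by rewrite addrC subrK.
have hw : enorm w <= h * (enorm (vx) + eta).
  rewrite wE; apply: le_trans (ler_enormD _ _) _.
  by rewrite enormZ gtr0_norm // mulrDr lerD2l mulrC.
have hw1 : enorm w <= h * (enorm (vx) + 1).
  by apply: le_trans hw _; rewrite ler_pM2l // lerD2l.
have hw2 : C * enorm w ^+ 2 <= h * (eps / 2).
  apply: (@le_trans _ _ (C * (h * (enorm (vx) + 1)) ^+ 2)).
    rewrite ler_pM2l // ler_sqr ?nnegrE ?enorm_ge0 //.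
    by rewrite mulr_ge0 ?addr_ge0 ?enorm_ge0 // ltW.
  have -> : C * (h * (enorm (vx) + 1)) ^+ 2 = h * (h * E) by rewrite /E; ring.
  by rewrite ler_pM2l.
have hdw : dot (Q (x t) *m (x t - xbar)) w <=
    h * dot (Q (x t) *m (x t - xbar)) (vx) + a * (eta * h).
  rewrite wE dotDr dotZr lerD2l; apply: le_trans (dot_le _ _) _.
  by rewrite -/a ler_wpM2l.
have KMa0 : 0 <= KM * a ^+ 2 by rewrite mulr_ge0 ?sqr_ge0 // ltW.
have hKw := ler_wpM2l KMa0 hw.
have := ler_wpM2l (ltW hpos) drift; have := ler_wpM2l (ltW hpos) etaD.
rewrite /D -/a.
have : 0 <= h * eta by rewrite mulr_ge0 // ltW.
move=> p1 p2 p3 p4; apply: le_trans p4 _; move: p1 p2 p3 hw2 hdw hKw.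
move: (r (x t)) (dot _ w) (dot _ _) (enorm (vx)) (enorm w) (KM * a ^+ 2) CL
  => r0 d1 d2 nv nw ka cl; lra.
Qed.

(** * Invariance and decay along curves *)

Lemma residual_real_abs_cont (b : R) (x : R -> 'cV[R]_n) : 0 <= b ->
  (forall t, 0 <= t -> t <= b -> S (x t)) -> abs_cont 0 b x ->
  real_abs_cont 0 b (fun t => r (x t) ^+ 2).
Proof.
move=> b0 Sx xac; have [B B0 xB] := abs_cont_bounded xbar b0 xac.
have [C C0 hC] := residual_lipschitz_on B0.
apply: (@small_incr_dominated R 0 b (fun s t => enorm (x t - x s))
  (fun s t => `|r (x t) ^+ 2 - r (x s) ^+ 2|) C C0 _ xac) => s t s0 st tb.
have t0 := le_trans s0 st; have sb := le_trans st tb.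
apply: le_trans (hC _ _ (Sx _ s0 sb) (Sx _ t0 tb) (xB _ s0 sb) (xB _ t0 tb)) _.
by rewrite ler_pM2l // lerDl subr_ge0.
Qed.

(* Clamping [r ^ 2] between [rad ^ 2] and [rad' ^ 2] gives a function which is
   nonincreasing without any a priori bound on [r] along the curve. *)
Lemma residual_invariant (b rad rad' : R) (x : R -> 'cV[R]_n) : 0 <= b ->
  (forall t, 0 <= t -> t <= b -> S (x t)) -> abs_cont 0 b x ->
  {ae (@lebesgue_measure R), forall t, 0 <= t -> t < b -> r (x t) < rad' ->
     is_derive (t : R^o) (1 : R^o) (x : R^o -> 'cV[R]_n) (v (x t))} ->
  0 <= rad -> rad < rad' -> CL * rad' <= 1 - rho ->
  r (x 0) <= rad -> r (x b) <= rad.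
Proof.
move=> b0 Sx xac dx rad0 radrad' CLrad' rx0.
pose f (s : R) := Num.min (Num.max s (rad ^+ 2)) (rad' ^+ 2).
have rr : rad ^+ 2 < rad' ^+ 2 by rewrite ltr_sqr ?nnegrE // (le_trans rad0) // ltW.
have fmax s : f s <= rad' ^+ 2 by rewrite ge_min lexx orbT.
have f_step s u (e : R) : 0 <= e -> u <= s + e -> f u <= f s + e.
  move=> e0 us; rewrite /f /Num.min /Num.max.
  by do 4 case: ifPn; rewrite -?leNgt; lra.
have f_lip s u : `|f u - f s| <= `|u - s|.
  rewrite ler_norml; have := ler_norm (u - s); have := ler_norm (s - u).
  rewrite (distrC s) => h1 h2; have := normr_ge0 (u - s) => h0.
  have := @f_step s u `|u - s| h0; have := @f_step u s `|u - s| h0; lra.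
have fle : f (r (x b) ^+ 2) <= f (r (x 0) ^+ 2).
  apply: (@real_abs_cont_nonincr R 0 b (fun t => f (r (x t) ^+ 2))) => //.
    apply: (@small_incr_dominated R 0 b
      (fun s t => `|r (x t) ^+ 2 - r (x s) ^+ 2|) _ 1 ltr01 _
      (residual_real_abs_cont b0 Sx xac)) => s t _ st _.
    by rewrite mul1r (le_trans (f_lip _ _)) // lerDl subr_ge0.
  apply: ae_lebesgueS dx => t dx t0 tb eps eps0.
  (* From [rad'] upwards the clamped function is at its maximum and cannot grow; below [rad'] the
     bound [CL * rad' <= 1 - rho] makes the drift nonpositive. *)
  have [big|small] := leP rad' (r (x t)).
    exists (b - t); first by rewrite subr_gt0.
    split; first by rewrite addrC subrK.
    apply: le_trans (fmax _) _; apply: (@le_trans _ _ (f (r (x t) ^+ 2))).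
      have : rad' ^+ 2 <= r (x t) ^+ 2.
        by rewrite ler_sqr ?nnegrE ?wnorm_ge0 // (le_trans rad0) // ltW.
      by rewrite le_min lexx andbT le_max => ->.
    by rewrite lerDl mulr_ge0 ?subr_ge0 // ltW.
  have [h0 h00 hh] := residual_dini (Sx t t0 (ltW tb)) erefl (dx t0 tb small) eps0.
  pose h := Num.min (h0 / 2) (b - t).
  have hpos : 0 < h by rewrite lt_min divr_gt0 //= subr_gt0.
  have thb : t + h <= b by rewrite -lerBrDl ge_min lexx orbT.
  have hlt : h < h0.
    by apply: (@le_lt_trans _ _ (h0 / 2)); rewrite ?ge_min ?lexx //; lra.
  exists h => //; split=> //.
  apply: f_step; first by rewrite mulr_ge0 // ltW.
  apply: le_trans (hh h hpos hlt (Sx _ (addr_ge0 t0 (ltW hpos)) thb)) _.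
  rewrite lerD2l mulrC ler_pM2r // gerDr mulNr oppr_le0.
  rewrite mulr_ge0 ?sqr_ge0 // mulr_ge0 ?subr_ge0 ?mulr_ge0 //; first exact: ltW.
  by apply: le_trans CLrad'; rewrite ler_pM2l ?CL_gt0 // ltW.
have f0 : f (r (x 0) ^+ 2) = rad ^+ 2.
  have : r (x 0) ^+ 2 <= rad ^+ 2 by rewrite ler_sqr ?nnegrE ?wnorm_ge0.
  rewrite /f => h; rewrite (max_idPr h); exact/min_idPl/ltW.
rewrite -ler_sqr ?nnegrE ?wnorm_ge0 //.
move: fle; rewrite f0 /f ge_min (leNgt (rad' ^+ 2)) rr orbF.
by rewrite ge_max => /andP[].
Qed.

(** Gronwall for [r ^ 2], with the rate evaluated at the worst radius [rad]; taking the square root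
    removes the factor 2 from the exponent. *)
Lemma residual_decay (b rad : R) (x : R -> 'cV[R]_n) : 0 <= b ->
  (forall t, 0 <= t -> t <= b -> S (x t)) -> abs_cont 0 b x ->
  {ae (@lebesgue_measure R), forall t, 0 <= t -> t < b ->
     is_derive (t : R^o) (1 : R^o) (x : R^o -> 'cV[R]_n) (v (x t))} ->
  (forall t, 0 <= t -> t <= b -> r (x t) <= rad) ->
  r (x b) <= expR (- (lambda * (1 - rho - CL * rad) * b)) * r (x 0).
Proof.
move=> b0 Sx xac dx rrad; set eta := 1 - rho - CL * rad.
have h : r (x b) ^+ 2 <= expR (- (2 * lambda * eta) * b) * r (x 0) ^+ 2.
  apply: (ae_gronwall b0 (residual_real_abs_cont b0 Sx xac)) => [|t _ _];
    last exact: sqr_ge0.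
  apply: ae_lebesgueS dx => t dx t0 tb eps eps0.
  have [h0 h00 hh] := residual_dini (Sx t t0 (ltW tb)) erefl (dx t0 tb) eps0.
  exists h0 => // h hpos hlt thb.
  apply: le_trans (hh h hpos hlt (Sx _ (addr_ge0 t0 (ltW hpos)) thb)) _.
  rewrite lerD2l ler_pM2l // lerD2r ler_wpM2r ?sqr_ge0 // lerN2.
  rewrite ler_pM2l ?mulr_gt0 // lerD2l lerN2 ler_pM2l ?CL_gt0 //.
  by rewrite rrad // ltW.
rewrite -ler_sqr ?nnegrE ?mulr_ge0 ?expR_ge0 ?wnorm_ge0 //.
apply: le_trans h _; rewrite exprMn -expRM_natl.
by rewrite le_eqVlt; apply/orP; left; apply/eqP; congr (expR _ * _); ring.
Qed.

(** * The truncated field and global existence *)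

Local Notation crit := ((1 - rho) / CL).

Lemma crit_mul : CL * crit = 1 - rho.
Proof. by rewrite mulrC divfK // gt_eqF ?CL_gt0. Qed.

(** Sublevel sets of [r] need not be convex, as the metric varies with the point. This convex set
    contains the one of radius [rad] when [B = Num.sqrt L * rad], and can be projected on. *)
Definition ball_part (B : R) : set 'cV[R]_n :=
  S `&` [set x | enorm (x - xbar) <= B].

(** The constant of [Tmap_lipschitz] with the step bounded by [2 * L * B], plus 1 for the identity
    part of the field. *)
Definition field_lipschitz (B : R) : R :=
  lambda * (L * (L + L ^+ 2 * KM * (2 * L * B) + alpha * K) + 1).

Lemma field_lipschitz_gt0 B : 0 <= B -> 0 < field_lipschitz B.
Proof.
move=> B0; rewrite mulr_gt0 // ltr_wpDl // mulr_ge0 ?(ltW L_gt0) //.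
rewrite !addr_ge0 ?mulr_ge0 ?exprn_ge0 //; exact: ltW.
Qed.

Lemma Tmap_lipschitz_on B p q : ball_part B p -> ball_part B q ->
  lambda * (enorm (T p - T q) + enorm (p - q)) <=
    field_lipschitz B * enorm (p - q).
Proof.
move=> [Sp pB] [Sq qB]; rewrite -mulrA ler_pM2l // mulrDl mul1r lerD2r.
apply: le_trans (Tmap_lipschitz Sp Sq) _; apply: ler_wpM2r; first exact: enorm_ge0.
rewrite ler_pM2l // lerD2r lerD2l ler_pM2l ?mulr_gt0 ?exprn_gt0 //.
apply: le_trans (Tmap_displacement Sq) _.
by rewrite ler_pM2l // mulr_gt0.
Qed.

Lemma field_lipschitz_on B p q : ball_part B p -> ball_part B q ->
  enorm (v p - v q) <= field_lipschitz B * enorm (p - q).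
Proof.
move=> pB qB; apply: le_trans (Tmap_lipschitz_on pB qB).
have -> : v p - v q = lambda *: ((T p - T q) - (p - q)).
  by rewrite -scalerBr !opprB addrACA [X in _ = _ *: X]addrACA (addrC (- p)).
by rewrite enormZ gtr0_norm // ler_pM2l // ler_enormB.
Qed.

Lemma ball_part_neq0 B : 0 <= B -> ball_part B !=set0.
Proof. by move=> B0; exists xbar; split=> //=; rewrite subrr enorm0. Qed.

Lemma ball_part_closed B : closed (ball_part B).
Proof.
move=> p clp.
have near_p (e : R) : 0 < e -> exists2 s, ball_part B s & enorm (s - p) < e.
  move=> e0; have n0 : 0 < n.+1%:R :> R by [].
  have [s [sB]] := clp _ (nbhsx_ballx p _ (divr_gt0 e0 n0)).
  rewrite -ball_normE /= distrC => sp; exists s => //.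
  apply: le_lt_trans (enorm_le_normr _) _.
  apply: (@le_lt_trans _ _ (n.+1%:R * `|s - p|)).
    by rewrite ler_wpM2r // ler_nat.
  by rewrite mulrC -ltr_pdivlMr.
split.
  by apply: closed_limit => // e /near_p[s [Ss _] sp]; exists s.
rewrite /=; apply/ler_addgt0Pr => e /near_p[s [_ /= sB] sp].
have := ler_enorm_distD s p xbar; rewrite (enormC p s); lra.
Qed.

Lemma ball_part_convex B : convex_set (ball_part B).
Proof.
move=> x y k; rewrite !inE => -[Sx /= xB] [Sy /= yB]; split.
  by have := S_convex k (mem_set Sx) (mem_set Sy); rewrite inE.
have k0 : 0 <= k%:inum :> R by [].
have k1 : k%:inum <= 1 :> R by [].
change (enorm (k%:inum *: x + (1 - k%:inum) *: y - xbar) <= B).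
have -> : k%:inum *: x + (1 - k%:inum) *: y - xbar =
    k%:inum *: (x - xbar) + (1 - k%:inum) *: (y - xbar).
  by apply/matrixP => i j; rewrite !mxE; ring.
apply: le_trans (ler_enormD _ _) _.
rewrite !enormZ (ger0_norm k0) ger0_norm ?subr_ge0 //.
have k2 : 0 <= 1 - k%:inum :> R by rewrite subr_ge0.
have := ler_wpM2l k0 xB; have := ler_wpM2l k2 yB; lra.
Qed.

Lemma residual_ball x rad : S x -> r x <= rad -> ball_part (Num.sqrt L * rad) x.
Proof.
move=> Sx rx; split=> //=; apply: le_trans (enorm_le_residual _ Sx) _.
by rewrite ler_wpM2l ?sqrtr_ge0.
Qed.

(** The Picard solution is differentiated at positive times only; this discards time 0. *)
Lemma ae_neq0 : {ae (@lebesgue_measure R), forall t : R, t != 0}.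
Proof.
exists [set 0]; split; [exact: measurable_set1|exact: lebesgue_measure_set1|].
by move=> t /= /negP; rewrite negbK => /eqP.
Qed.

(* Composing [T] with the Euclidean projection on a bounded part of [S] makes the
   field globally Lipschitz; the solution never notices, since it keeps
   [r <= rad]. *)
Lemma flow_exists rad x0 : 0 < rad -> rad < crit -> S x0 -> r x0 <= rad ->
  exists2 x : R -> 'cV[R]_n, trajectory S v (BInfty R false) x & x 0 = x0.
Proof.
move=> rad0 rad_lt Sx0 rx0.
(* Strictly above [rad] to leave a zone where the truncation is inactive, strictly below the
   critical radius to keep the drift nonpositive there. *)
pose rad' := (rad + crit) / 2.
have [rad_lt' rad'_lt] := midf_lt rad_lt; rewrite -/rad' in rad_lt' rad'_lt.
have crit' : CL * rad' <= 1 - rho.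
  by rewrite -crit_mul ler_pM2l ?CL_gt0 // ltW.
have rad'0 : 0 < rad' by exact: lt_trans rad_lt'.
pose B := Num.sqrt L * rad'.
have B0 : 0 <= B by rewrite mulr_ge0 ?sqrtr_ge0 // ltW.
pose P := Defs.proj (ball_part B) 1%:M.
have PB p : ball_part B (P p).
  apply: proj_mem; [exact: ball_part_neq0|exact: ball_part_closed|
    exact: ball_part_convex|exact: spd1].
have Pid p : S p -> r p <= rad' -> P p = p.
  move=> Sp rp; apply: proj_self; [exact: ball_part_neq0|exact: ball_part_closed|
    exact: ball_part_convex|exact: spd1|exact: residual_ball].
have Plip p q : enorm (P p - P q) <= enorm (p - q).
  apply: proj1_nonexpansive; [exact: ball_part_neq0|exact: ball_part_closed|
    exact: ball_part_convex].
pose f p := lambda *: (T (P p) - p).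
have f_lip p q : enorm (f p - f q) <= (field_lipschitz B + lambda) * enorm (p - q).
  have -> : f p - f q = lambda *: (T (P p) - T (P q)) - lambda *: (p - q).
    by rewrite -!scalerBr !opprB addrACA [X in _ = _ *: X]addrACA (addrC (- p)).
  apply: le_trans (ler_enormB _ _) _; rewrite !enormZ gtr0_norm // mulrDl lerD2r.
  have := Tmap_lipschitz_on (PB p) (PB q).
  have := ler_wpM2l (ltW (field_lipschitz_gt0 B0)) (Plip p q).
  have := mulr_ge0 (ltW lambda_gt0) (enorm_ge0 (P p - P q)); lra.
(* The factor [n.+1] pays for passing to the sup norm of the Picard iteration. *)
pose Lam := (field_lipschitz B + lambda) * n.+1%:R.
have FL0 : 0 < field_lipschitz B + lambda by rewrite addr_gt0 // field_lipschitz_gt0.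
have Lam0 : 0 < Lam by rewrite mulr_gt0.
have f_sup p q : `|f p - f q| <= Lam * `|p - q|.
  apply: le_trans (normr_le_enorm _) _; apply: le_trans (f_lip p q) _.
  rewrite -mulrA ler_pM2l //; apply: le_trans (enorm_le_normr _) _.
  by rewrite ler_wpM2r // ler_nat.
have [x [x_0 dx x_lip]] := picard_global x0 Lam0 f_sup.
have xac b : 0 <= b -> forall c, 0 <= c -> abs_cont c b x.
  move=> b0 c c0; have [C C0 hC] := x_lip b b0.
  have nC0 : 0 < n.+1%:R * C by rewrite mulr_gt0.
  apply: (lipschitz_abs_cont nC0) => s t cs st tb.
  apply: le_trans (enorm_le_normr _) _; rewrite -mulrA.
  apply: ler_pM => //; [by rewrite ler_nat|].
  by apply: hC => //; exact: le_trans cs.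
have Sx b : 0 <= b -> S (x b).
  move=> b0; apply: (@convex_flow_invariant R n S (T \o P) lambda b x) => //.
  - by move=> p; exact: Tmap_mem.
  - exact: xac.
  - apply: ae_lebesgueS ae_neq0 => t t0 tge0 _; apply: dx.
    by rewrite lt_neqAle eq_sym t0.
  - by rewrite x_0.
have rx b : 0 <= b -> r (x b) <= rad.
  move=> b0; apply: (@residual_invariant b rad rad' x) => //.
  - by move=> t t0 _; exact: Sx.
  - exact: xac.
  - apply: ae_lebesgueS ae_neq0 => t t0 tge0 _ rt.
    have tgt0 : 0 < t by rewrite lt_neqAle eq_sym t0.
    by have := dx t tgt0; rewrite /f Pid ?(ltW rt) //; exact: Sx.
  - exact: ltW.
  - by rewrite x_0.
exists x => //; split.
- by rewrite in_itv /= lexx.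
- by move=> t; rewrite in_itv /= andbT; exact: Sx.
- move=> c d; rewrite !in_itv /= !andbT => c0 d0; exact: xac.
- apply: ae_lebesgueS ae_neq0 => t t0; rewrite in_itv /= andbT => tge0.
  have tgt0 : 0 < t by rewrite lt_neqAle eq_sym t0.
  have := dx t tgt0; rewrite /f Pid //; first exact: Sx.
  exact: le_trans (rx t tge0) (ltW rad_lt').
Qed.

(** * Arbitrary trajectories *)

Lemma itv_from0_mem (e : itv_bound R) s t : t \in Interval (BLeft 0) e ->
  0 <= s -> s <= t -> s \in Interval (BLeft 0) e.
Proof.
rewrite !itv_boundlr => /andP[_ te] s0 st; rewrite bnd_simp s0 /=.
by apply: le_trans te; rewrite bnd_simp.
Qed.

Lemma trajectory_restrict (w : 'cV[R]_n -> 'cV[R]_n) (e : itv_bound R) x b :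
  trajectory S w e x -> b \in Interval (BLeft 0) e ->
  [/\ 0 <= b, forall t, 0 <= t -> t <= b -> S (x t), abs_cont 0 b x
    & {ae (@lebesgue_measure R), forall t, 0 <= t -> t < b ->
        is_derive (t : R^o) (1 : R^o) (x : R^o -> 'cV[R]_n) (w (x t))}].
Proof.
move=> [zJ SJ acJ dJ] bJ.
have b0 : 0 <= b by move: bJ; rewrite itv_boundlr bnd_simp => /andP[].
split=> //; first by move=> t t0 tb; apply: SJ; exact: itv_from0_mem bJ t0 tb.
  exact: acJ.
apply: ae_lebesgueS dJ => t dt t0 tb; apply: dt.
by apply: itv_from0_mem bJ t0 _; exact: ltW.
Qed.

Lemma trajectory_invariant rad (e : itv_bound R) x : 0 < rad -> rad < crit ->
  trajectory S v e x -> r (x 0) <= rad ->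
  forall t, t \in Interval (BLeft 0) e -> r (x t) <= rad.
Proof.
move=> rad0 rad_lt trx r0 t tJ.
have [t0 Sx xac dx] := trajectory_restrict trx tJ.
have [mid_gt mid_lt] := midf_lt rad_lt.
apply: (@residual_invariant t rad ((rad + crit) / 2) x) => //.
- by apply: ae_lebesgueS dx => s ds s0 st _; exact: ds.
- exact: ltW.
- by rewrite -[leRHS]crit_mul ler_pM2l ?CL_gt0 // ltW.
Qed.

(** The constructed global trajectory and the given one both keep [r <= rad], hence stay in one
    bounded part of [S], where the field is Lipschitz and [ode_unique] applies. *)
Lemma trajectory_extends rad (e : itv_bound R) x : 0 < rad -> rad < crit ->
  trajectory S v e x -> r (x 0) <= rad ->
  exists2 y, trajectory S v (BInfty R false) y &
    forall t, t \in Interval (BLeft 0) e -> y t = x t.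
Proof.
move=> rad0 rad_lt trx r0.
have Sx0 : S (x 0) by have [zJ SJ _ _] := trx; exact: SJ.
have [y try y0] := flow_exists rad0 rad_lt Sx0 r0.
exists y => // t tJ.
have tJ' : t \in Interval (BLeft 0) (BInfty R false).
  by move: tJ; rewrite !itv_boundlr => /andP[->].
have [t0 Sx xac dx] := trajectory_restrict trx tJ.
have [_ Sy yac dy] := trajectory_restrict try tJ'.
have ry0 : r (y 0) <= rad by rewrite y0.
apply: (@ode_unique R n (ball_part (Num.sqrt L * rad)) v
  (field_lipschitz (Num.sqrt L * rad)) t y x) => //.
- by move=> p q; exact: field_lipschitz_on.
- move=> s s0 st; apply: residual_ball (Sy s s0 st) _.
  by apply: (trajectory_invariant rad0 rad_lt try ry0); exact: itv_from0_mem tJ' s0 st.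
- move=> s s0 st; apply: residual_ball (Sx s s0 st) _.
  by apply: (trajectory_invariant rad0 rad_lt trx r0); exact: itv_from0_mem tJ s0 st.
Qed.

Lemma trajectory_decay rad (e : itv_bound R) x : 0 < rad -> rad < crit ->
  trajectory S v e x -> r (x 0) <= rad ->
  forall t, t \in Interval (BLeft 0) e ->
    r (x t) <= expR (- (lambda * (1 - rho - CL * rad) * t)) * r (x 0) /\
    enorm (x t - xbar) <=
      L * expR (- (lambda * (1 - rho - CL * rad) * t)) * enorm (x 0 - xbar).
Proof.
move=> rad0 rad_lt trx r0 t tJ.
have [t0 Sx xac dx] := trajectory_restrict trx tJ.
have rt s : 0 <= s -> s <= t -> r (x s) <= rad.
  move=> s0 st; apply: (trajectory_invariant rad0 rad_lt trx r0).
  exact: itv_from0_mem tJ s0 st.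
have dec := residual_decay t0 Sx xac dx rt; split=> //.
apply: le_trans (enorm_le_residual _ (Sx t t0 (lexx t))) _.
move: dec; set ex := expR _ => dec.
(* One [Num.sqrt L] comes from leaving the weighted norm at time [t], the other from entering it at
   time 0; together they give [L]. *)
apply: (@le_trans _ _ (Num.sqrt L * (ex * (Num.sqrt L * enorm (x 0 - xbar))))).
  rewrite ler_wpM2l ?sqrtr_ge0 //; apply: le_trans dec _.
  by rewrite ler_wpM2l ?expR_ge0 //; exact: residual_le_enorm (Sx 0 (lexx 0) t0).
have -> : Num.sqrt L * (ex * (Num.sqrt L * enorm (x 0 - xbar))) =
    Num.sqrt L ^+ 2 * ex * enorm (x 0 - xbar) by ring.
by rewrite sqr_sqrtr // ltW.
Qed.

Lemma residual_lt x rad : S x -> enorm (x - xbar) < rad / Num.sqrt L -> r x < rad.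
Proof.
move=> Sx; rewrite ltr_pdivlMr ?sqrtr_gt0 // mulrC.
exact: le_lt_trans (residual_le_enorm Sx).
Qed.

End Metric.

Lemma sup_open_interval (R : realType) (c : R) : 0 < c ->
  sup [set x : R | 0 < x /\ x < c] = c.
Proof.
move=> c0; set A := [set x | _].
have Ac2 : A (c / 2) by rewrite /A /= divr_gt0 // ltr_pdivrMr // ltr_pMr ?ltr1n.
have ubA : ubound A c by move=> x [_ /ltW].
have hsA : has_sup A by split; [exists (c / 2)|exists c].
apply/le_anti; rewrite ge_sup //=; last by exists (c / 2).
rewrite leNgt; apply/negP => ltc.
have [lt1 lt2] := midf_lt ltc.
have c2_le : c / 2 <= sup A by exact: sup_upper_bound.
have sup0 : 0 < sup A by apply: lt_le_trans c2_le; rewrite divr_gt0.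
have : (sup A + c) / 2 <= sup A.
  by apply: sup_upper_bound => //; split=> //; exact: lt_trans lt1.
by rewrite leNgt lt1.
Qed.

Lemma powR_3half (R : realType) (a : R) : 0 < a -> a `^ (3 / 2) = a * Num.sqrt a.
Proof.
move=> a0; have -> : 3 / 2 = 1 + 2^-1 :> R by field.
by rewrite powRD ?gt_eqF ?implybT // powRr1 ?powR12_sqrt ?ltW.
Qed.

Theorem theorem16 (R : realType) (n : nat) (S : set 'cV[R]_n)
    (F : 'cV[R]_n -> 'cV[R]_n) (M : 'cV[R]_n -> 'M[R]_n)
    (L K KM mu lambda alpha : R) (xbar : 'cV[R]_n)
    (S_neq0 : S !=set0) (S_closed : closed S) (S_convex : convex_set S)
    (F_cont : continuous F) (M_spd : forall x, spd (M x))
    (L_ge1 : 1 <= L) (K_gt0 : 0 < K) (KM_gt0 : 0 < KM) (mu_gt0 : 0 < mu)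
    (M_bound : forall x, S x -> opnorm (M x) <= L)
    (Minv_bound : forall x, S x -> opnorm (invmx (M x)) <= L)
    (F_lip : forall x y, S x -> S y -> enorm (F x - F y) <= K * enorm (x - y))
    (M_lip : forall x y, S x -> S y ->
      opnorm (M x - M y) <= KM * enorm (x - y))
    (F_mono : forall x y, S x -> S y ->
      mu * enorm (x - y) ^+ 2 <= dot (F x - F y) (x - y))
    (lambda_gt0 : 0 < lambda)
    (alpha_gt0 : 0 < alpha) (alpha_lt : alpha < 2 * mu / (L * K ^+ 2))
    (xbar_sol : SOL F S xbar) :
  let rho := Num.sqrt (1 - 2 * alpha * mu / L + alpha ^+ 2 * K ^+ 2) in
  let v := fun x => lambda *: (Tmap S F M alpha x - x) in
  let r := fun x => wnorm (invmx (M x)) (x - xbar) in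
  let CL := 2^-1 * L `^ (3 / 2) * KM * (1 + rho) in
  let eta := fun rad : R => (1 - rho) - CL * rad in
  let rad_half := (1 - rho) / (L `^ (3 / 2) * KM * (1 + rho)) in
  [/\ forall rad : R, 0 < rad -> rad < (1 - rho) / CL ->
        [/\ 0 < eta rad,
            positively_invariant S v [set x | S x /\ r x <= rad],
            (forall x0, S x0 -> r x0 <= rad ->
               exists2 x : R -> 'cV[R]_n,
                 trajectory S v (BInfty R false) x & x 0 = x0) /\
            (forall (e : itv_bound R) (x : R -> 'cV[R]_n),
               trajectory S v e x -> r (x 0) <= rad ->
               exists2 y : R -> 'cV[R]_n, trajectory S v (BInfty R false) y &
                 forall t, t \in Interval (BLeft 0) e -> y t = x t),
            (forall (e : itv_bound R) (x : R -> 'cV[R]_n),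
               trajectory S v e x -> r (x 0) <= rad ->
               forall t, t \in Interval (BLeft 0) e ->
                 r (x t) <= expR (- (lambda * eta rad * t)) * r (x 0) /\
                 enorm (x t - xbar) <=
                   L * expR (- (lambda * eta rad * t)) * enorm (x 0 - xbar))
          & (forall x0, S x0 -> enorm (x0 - xbar) < rad / Num.sqrt L ->
               r x0 < rad)],
      [/\ 0 < rad_half /\ rad_half < (1 - rho) / CL,
          rad_half = sup [set rad : R | 0 < rad /\ rad < (1 - rho) / CL] / 2,
          eta rad_half = (1 - rho) / 2,
          rad_half / Num.sqrt L = (1 - rho) / (L ^+ 2 * KM * (1 + rho))
        & (forall x0, S x0 ->
             enorm (x0 - xbar) < (1 - rho) / (L ^+ 2 * KM * (1 + rho)) ->
             r x0 < rad_half)]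
    & (eta rad @[rad --> 0^'+] --> 1 - rho) /\
      (eta rad @[rad --> ((1 - rho) / CL)^'-] --> 0)].
Proof.
have L_gt0 : 0 < L by exact: lt_le_trans ltr01 L_ge1.
rewrite powR_3half //.
move=> rho v r CL eta rad_half.
have CL0 : 0 < CL by exact: (CL_gt0 K mu alpha L_ge1 KM_gt0).
have rho1 : rho < 1 by exact: (rho_lt1 L_ge1 K_gt0 alpha_gt0 alpha_lt).
have rho0 : 0 <= rho by exact: sqrtr_ge0.
have sL : 0 < Num.sqrt L by rewrite sqrtr_gt0.
have crit0 : 0 < (1 - rho) / CL by rewrite divr_gt0 // subr_gt0.
have rho1_gt0 : 0 < 1 + rho by rewrite ltr_wpDr.
(* The [2^-1] inside [CL] makes this radius exactly half of the critical one. *)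
have halfE : rad_half = (1 - rho) / CL / 2.
  rewrite /rad_half /CL; clearbody rho; field.
  by rewrite !gt_eqF.
have half_sqrtE : rad_half / Num.sqrt L = (1 - rho) / (L ^+ 2 * KM * (1 + rho)).
  have -> : L ^+ 2 = L * Num.sqrt L * Num.sqrt L.
    by rewrite -mulrA -expr2 sqr_sqrtr ?ltW.
  rewrite /rad_half; clearbody rho; field.
  by rewrite !gt_eqF.
split.
- move=> rad rad0 rad_lt; split.
  + by rewrite subr_gt0 mulrC -ltr_pdivlMr.
  + move=> e x trx [_ r0] t tJ; split.
      by have [_ SJ _ _] := trx; exact: SJ.
    exact: (trajectory_invariant S_neq0 S_closed S_convex M_spd L_ge1 K_gt0 KM_gt0
      M_bound Minv_bound F_lip M_lip F_mono lambda_gt0 alpha_gt0 alpha_lt xbar_sol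
      rad0 rad_lt trx r0 tJ).
  + split=> [x0 Sx0 rx0|e x trx r0].
      exact: (flow_exists S_neq0 S_closed S_convex M_spd L_ge1 K_gt0 KM_gt0
        M_bound Minv_bound F_lip M_lip F_mono lambda_gt0 alpha_gt0 alpha_lt xbar_sol
        rad0 rad_lt Sx0 rx0).
    exact: (trajectory_extends S_neq0 S_closed S_convex M_spd L_ge1 K_gt0 KM_gt0
      M_bound Minv_bound F_lip M_lip F_mono lambda_gt0 alpha_gt0 alpha_lt xbar_sol
      rad0 rad_lt trx r0).
  + move=> e x trx r0 t tJ.
    exact: (trajectory_decay S_neq0 S_closed S_convex M_spd L_ge1 K_gt0 KM_gt0
      M_bound Minv_bound F_lip M_lip F_mono lambda_gt0 alpha_gt0 alpha_lt xbar_sol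
      rad0 rad_lt trx r0 tJ).
  + by move=> x0; exact: (residual_lt L_ge1 Minv_bound).
- split=> //.
  + by rewrite halfE divr_gt0 //= ltr_pdivrMr // ltr_pMr ?ltr1n.
  + by rewrite sup_open_interval.
  + rewrite /eta halfE; field; exact: lt0r_neq0.
  + by move=> x0 Sx0; rewrite -half_sqrtE; exact: (residual_lt L_ge1 Minv_bound).
(* [eta] is affine, so both one-sided limits are restrictions of ordinary limits. *)
- have eta_cvg (c : R) : eta rad @[rad --> c] --> eta c.
    by apply: cvgB; [exact: cvg_cst|apply: cvgM; [exact: cvg_cst|exact: cvg_id]].
  split.
    have := cvg_at_right_filter (eta_cvg 0).
    by rewrite [X in _ --> X]/eta mulr0 subr0.
  have := cvg_at_left_filter (eta_cvg ((1 - rho) / CL)).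
  by rewrite [X in _ --> X]/eta (mulrC CL (_ / _)) divfK ?gt_eqF // subrr.
Qed.
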